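(* Let $X=\{X(j):j\in\mathbb Z\}$ be a centred wide-sense stationary real random sequence with $\mathrm{Var}(X(0))=1$ and spectral measure $\mathsf S$ on $\mathbb T=[-\pi,\pi]$ (endpoints identified), let $s(u)\,du$ be the continuous component of $\mathsf S$, and let $m\in\mathbb N$. Then: (i) $X$ is not linearly maximally rigid on $\{-m,\dots,m\}$ if and only if the number of poles of $s^{-1}$ on $[-\pi,\pi)$, counted with multiplicity, is at most $2m$. (ii) $X$ is not (linearly) $0$-rigid on $\{-m,\dots,m\}$ if and only if there are at most $2m$ poles of $s^{-1}$ on $[-\pi,\pi)$, counted with multiplicity, and $0$ is not a pole.
   Context: $\mathbb N=\{0,1,2,\dots\}$; $1/0=\infty$. Wide-sense stationary means that $c(j)=\mathbf E[X(j')X(j'+j)]$ does not depend on $j'$; the spectral measure $\mathsf S$ is the finite symmetric non-negative measure on $\mathbb T$ with $c(j)=(2\pi)^{-1}\int_{\mathbb T}e^{iju}\mathsf S(du)$. Its continuous component is its absolutely continuous part. A point $u_0\in[-\pi,\pi)$ is a pole of $s^{-1}$ if $s^{-1}$ is not integrable on any neighbourhood of $u_0$ in $\mathbb T$; its multiplicity (order) is the least $k\in\mathbb N$ such that $\int_{u_0-\varepsilon}^{u_0+\varepsilon}|e^{iu}-e^{iu_0}|^{2k}s(u)^{-1}du<\infty$ for some $\varepsilon>0$ ($\infty$ if there is no such $k$); $s$ is extended $2\pi$-periodically. For $\gamma:\mathbb Z\to\mathbb C$ with finite support, $X(\gamma)=\sum_j\gamma(j)X(j)$. $X$ is linearly $\gamma$-rigid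 on a finite set $A\subset\mathbb Z$ if $\inf_h\mathrm{Var}(X(\gamma)-X(h))=0$, the infimum being over finitely supported $h$ vanishing on $A$. It is linearly $0$-rigid on $A$ if this holds for $\gamma=1_A$, and linearly maximally rigid on $A$ if this holds for all $\gamma$ supported in $A$. *)

(* Defs.v *)
From HB Require Import structures.
From mathcomp Require Import all_boot all_order all_algebra.
From mathcomp Require Import complex.
From mathcomp Require Import all_classical all_reals all_analysis.

Set Implicit Arguments.
Unset Strict Implicit.
Unset Printing Implicit Defensive.

Import Order.TTheory GRing.Theory Num.Theory.
Import numFieldNormedType.Exports.

Local Open Scope classical_set_scope.
Local Open Scope ring_scope.

Definition expi (R : realType) (u : R) : R[i] := (cos u +i* sin u)%C.

Definition cRintegral d (T : measurableType d) (R : realType)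
    (mu : {measure set T -> \bar R}) (D : set T) (f : T -> R[i]) : R[i] :=
  ((\int[mu]_(x in D) complex.Re (f x)) +i*
   (\int[mu]_(x in D) complex.Im (f x)))%C.

Definition cexpectation d (Om : measurableType d) (R : realType)
    (P : probability Om R) (Z : Om -> R[i]) : R[i] :=
  cRintegral P [set: Om] Z.

(* Var Z = E |Z - E Z|^2 for a complex random variable. *)
Definition cvariance d (Om : measurableType d) (R : realType)
    (P : probability Om R) (Z : Om -> R[i]) : \bar R :=
  ('E_P[fun w => (Normc.normc (Z w - cexpectation P Z) ^+ 2)%R])%E.

Definition square_integrable d (Om : measurableType d) (R : realType)
    (P : probability Om R) (X : int -> {RV P >-> R}) : Prop :=
  forall j, (X j : Om -> R) \in Lfun P 2.

Definition centred d (Om : measurableType d) (R : realType)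
    (P : probability Om R) (X : int -> {RV P >-> R}) : Prop :=
  forall j, ('E_P[X j] = 0)%E.

Definition autocov d (Om : measurableType d) (R : realType)
    (P : probability Om R) (X : int -> {RV P >-> R}) (j : int) : R :=
  fine ('E_P[fun w => (X 0 w * X j w)%R])%E.

Definition wide_sense_stationary d (Om : measurableType d) (R : realType)
    (P : probability Om R) (X : int -> {RV P >-> R}) : Prop :=
  forall j j' : int,
    ('E_P[fun w => (X j' w * X (j' + j) w)%R] =
     'E_P[fun w => (X 0 w * X j w)%R])%E.

(* The torus is represented by its fundamental domain [-pi, pi[. *)
Definition torus (R : realType) : set (measurableTypeR R) :=
  [set` `[- pi, pi[ ].
Arguments torus R : clear implicits.

(* The point -pi of the torus is its own opposite, so that symmetry only has
   to be required inside ]-pi, pi[. *)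
Definition torus_symmetric (R : realType)
    (S : {measure set (measurableTypeR R) -> \bar R}) : Prop :=
  forall B : set (measurableTypeR R), measurable B ->
    B `<=` [set` `]- pi, pi[ ] -> S [set - u | u in B] = S B.

Definition is_spectral_measure (R : realType) (c : int -> R)
    (S : {finite_measure set (measurableTypeR R) -> \bar R}) : Prop :=
  [/\ S (~` torus R) = 0%E,
      torus_symmetric S &
      forall j : int,
        (c j)%:C%C = ((2 * pi)^-1)%:C%C *
          cRintegral S (torus R) (fun u => expi (j%:~R * u))].

Definition mutually_singular d (T : measurableType d) (R : realType)
    (mu nu : {measure set T -> \bar R}) : Prop :=
  exists2 N : set T, measurable N & mu N = 0%E /\ nu (~` N) = 0%E.

(* [s] is (a version of) the density of the absolutely continuous part in the
   Lebesgue decomposition of [S], extended 2pi-periodically to the line. *)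
Definition is_ac_density (R : realType)
    (S : {finite_measure set (measurableTypeR R) -> \bar R})
    (s : measurableTypeR R -> R) : Prop :=
  [/\ measurable_fun [set: measurableTypeR R] s,
      forall u, 0 <= s u,
      periodic (s : R -> R) (pi *+ 2) &
      exists2 nu : {measure set (measurableTypeR R) -> \bar R},
        mutually_singular lebesgue_measure nu &
        forall B : set (measurableTypeR R), measurable B ->
          S B = (\int[lebesgue_measure]_(u in B `&` torus R) (s u)%:E
                 + nu B)%E].

(* The inverse on [\bar R] satisfies 0^-1 = +oo. *)
Definition inv_density (R : realType) (s : measurableTypeR R -> R)
    (u : measurableTypeR R) : \bar R := ((s u)%:E^-1)%E.

(* As [s] is periodic, small neighbourhoods in the torus can be taken in R. *)
Definition is_pole (R : realType) (s : measurableTypeR R -> R) (u0 : R)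
    : Prop :=
  forall U : set R, open_nbhs u0 U ->
    ~ lebesgue_measure.-integrable (U : set (measurableTypeR R))
        (inv_density s).

Definition cancels_pole (R : realType) (s : measurableTypeR R -> R) (u0 : R)
    (k : nat) : Prop :=
  exists2 e : R, 0 < e &
    (\int[lebesgue_measure]_(u in [set` `[u0 - e, u0 + e]%R])
       ((Normc.normc (expi u - expi u0) ^+ (2 * k))%:E * inv_density s u)
     < +oo)%E.

(* Least such [k]; the infimum of the empty set is +oo. *)
Definition pole_order (R : realType) (s : measurableTypeR R -> R) (u0 : R)
    : \bar R :=
  ereal_inf [set (k%:R)%:E | k in cancels_pole s u0].

Definition nb_poles (R : realType) (s : measurableTypeR R -> R) : \bar R :=
  \esum_(u in [set u : R | - pi <= u < pi /\ is_pole s u]) pole_order s u.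

Definition finitely_supported (R : realType) (g : int -> R[i]) : Prop :=
  finite_set [set j | g j != 0].

Definition lin_comb d (Om : measurableType d) (R : realType)
    (P : probability Om R) (X : int -> {RV P >-> R}) (g : int -> R[i])
    (w : Om) : R[i] :=
  \sum_(j \in [set: int]) g j * (X j w)%:C%C.

Definition linearly_rigid d (Om : measurableType d) (R : realType)
    (P : probability Om R) (X : int -> {RV P >-> R}) (g : int -> R[i])
    (A : set int) : Prop :=
  ereal_inf [set cvariance P (fun w => lin_comb X g w - lin_comb X h w)
            | h in [set h : int -> R[i] | finitely_supported h /\
                                          (forall j, A j -> h j = 0)]] = 0%E.

Definition linearly_0_rigid d (Om : measurableType d) (R : realType)
    (P : probability Om R) (X : int -> {RV P >-> R}) (A : set int) : Prop :=
  linearly_rigid X \1_A A.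

Definition linearly_maximally_rigid d (Om : measurableType d) (R : realType)
    (P : probability Om R) (X : int -> {RV P >-> R}) (A : set int) : Prop :=
  forall g : int -> R[i], (forall j, ~ A j -> g j = 0) ->
    linearly_rigid X g A.

Definition int_window (m : nat) : set int := [set j | - m%:Z <= j <= m%:Z].

(* Main.v *)
Require Import Defs.
From HB Require Import structures.
From mathcomp Require Import all_boot all_order all_algebra.
From mathcomp Require Import complex.
From mathcomp Require Import all_classical all_reals all_analysis.
From mathcomp Require Import measurable_realfun.
From mathcomp Require Import zify ring lra.

Set Implicit Arguments.
Unset Strict Implicit.
Unset Printing Implicit Defensive.

Import Order.TTheory GRing.Theory Num.Theory.
Import numFieldNormedType.Exports.

Local Open Scope classical_set_scope.
Local Open Scope ring_scope.

(** The isometry [X j |-> expi (j * u)] into [L2(S)] ([spectral_isometry]) turns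
    the question into one about trigonometric polynomials: [g] is not rigid on
    the window [-m, m] when the trigonometric polynomial with coefficients [g] is
    at positive distance, in [L2(S)], from the span of the exponentials with
    frequencies outside the window.

    By duality this happens exactly when some trigonometric polynomial [p] with
    frequencies in the window has a non-zero pairing with [g] and satisfies that
    [|p| ^ 2 / s] is integrable. If [p] is given, it is orthogonal for [du] to
    all the exponentials outside the window, and Cauchy-Schwarz with the weight
    [s * s^-1] bounds the distance from below ([weighted_lower_bound],
    [nonrigid_of_poly]). Conversely a minimizing sequence yields a bounded linear
    functional that vanishes on the span and not on [g]
    ([separating_functional]). On trigonometric polynomials it is the integral
    against the conjugate of some [p] with frequencies in the window, which is
    thus bounded in the norm of [L2(S)] on trigonometric polynomials
    ([trig_pairing_bound]). Bounded pointwise limits of trigonometric polynomials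
    exhaust the bounded Borel functions on the torus
    ([bounded_measurable_pclosure]), hence the bound extends to these. Testing it
    on [p / (s + e)] away from the null set carrying the singular part of [S],
    and letting [e] tend to 0, shows that [|p| ^ 2 / s] is integrable
    ([weighted_upper_bound]).

    Multiplication by [expi (m * u)] makes [p] a polynomial of degree at most
    [2 * m] in [z = expi u]. If [|p| ^ 2 / s] is integrable, then [p] vanishes at
    each pole of [s^-1] at least to the order of the pole, and the degree bounds
    the number of poles ([nb_poles_le]). Conversely the product of the linear
    factors at the poles, with the orders as exponents, makes [|p| ^ 2 / s]
    locally integrable, hence integrable by compactness ([poly_of_nb_poles]).
    This gives (i), with [g] the coefficients of [p]. The pairing of [p] with the
    indicator of the window is the conjugate of [p.[1]], the value at [u = 0]; it
    can be non-zero exactly when no zero is forced there, that is, when 0 is not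
    a pole, which gives (ii). *)

(** * Complex exponentials *)

Section ComplexBasics.
Variable R : realType.
Implicit Types (z w : R[i]) (u v : R).

Definition nsq z : R := complex.Re z ^+ 2 + complex.Im z ^+ 2.

Lemma nsq_ge0 z : 0 <= nsq z.
Proof. by rewrite addr_ge0 ?sqr_ge0. Qed.

Lemma nsqM z w : nsq (z * w) = nsq z * nsq w.
Proof. case: z w => a b [c d]; rewrite /nsq /=; ring. Qed.

Lemma nsq1 : nsq 1 = 1.
Proof. by rewrite /nsq /= expr1n expr0n addr0. Qed.

Lemma nsqX z n : nsq (z ^+ n) = nsq z ^+ n.
Proof. by elim: n => [|n IH]; rewrite ?expr0 ?nsq1 // !exprS nsqM IH. Qed.

Lemma nsq_gt0 z : (0 < nsq z) = (z != 0).
Proof.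
case: z => a b; rewrite /nsq /= eq_complex /= lt0r addr_ge0 ?sqr_ge0 // andbT.
by rewrite paddr_eq0 ?sqr_ge0 // !sqrf_eq0.
Qed.

Lemma sqr_normcE z : Normc.normc z ^+ 2 = nsq z.
Proof. by case: z => a b; rewrite /nsq /= sqr_sqrtr // addr_ge0 ?sqr_ge0. Qed.

Lemma cReD z w : complex.Re (z + w) = complex.Re z + complex.Re w.
Proof. by case: z w => a b [c d]. Qed.
Lemma cImD z w : complex.Im (z + w) = complex.Im z + complex.Im w.
Proof. by case: z w => a b [c d]. Qed.
Lemma cReB z w : complex.Re (z - w) = complex.Re z - complex.Re w.
Proof. by case: z w => a b [c d]. Qed.
Lemma cImB z w : complex.Im (z - w) = complex.Im z - complex.Im w.
Proof. by case: z w => a b [c d]. Qed.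
Lemma cReM z w : complex.Re (z * w) =
  complex.Re z * complex.Re w - complex.Im z * complex.Im w.
Proof. by case: z w => a b [c d]. Qed.
Lemma cImM z w : complex.Im (z * w) =
  complex.Re z * complex.Im w + complex.Im z * complex.Re w.
Proof. by case: z w => a b [c d]. Qed.
Lemma cReJ z : complex.Re (z^*)%C = complex.Re z. Proof. by case: z. Qed.
Lemma cImJ z : complex.Im (z^*)%C = - complex.Im z. Proof. by case: z. Qed.

Lemma Re_sum I (r : seq I) (P : pred I) (F : I -> R[i]) :
  complex.Re (\sum_(i <- r | P i) F i) = \sum_(i <- r | P i) complex.Re (F i).
Proof. by apply: (big_morph (@complex.Re R)) => // x y; rewrite cReD. Qed.
Lemma Im_sum I (r : seq I) (P : pred I) (F : I -> R[i]) :
  complex.Im (\sum_(i <- r | P i) F i) = \sum_(i <- r | P i) complex.Im (F i).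
Proof. by apply: (big_morph (@complex.Im R)) => // x y; rewrite cImD. Qed.

Lemma nsq_real (x : R) : nsq (x%:C)%C = x ^+ 2.
Proof. by rewrite /nsq /= expr0n addr0. Qed.

Lemma nsqE z : nsq z = complex.Re (z * (z^*)%C).
Proof. case: z => a b; rewrite /nsq /=; ring. Qed.

Lemma conjM z w : ((z * w)^*)%C = (z^*)%C * (w^*)%C.
Proof.
case: z w => a b [c d]; apply/eqP; rewrite eq_complex /=.
by apply/andP; split; apply/eqP; ring.
Qed.

Lemma conjD z w : ((z + w)^*)%C = (z^*)%C + (w^*)%C.
Proof. by case: z w => a b [c d]; rewrite /= opprD. Qed.

Lemma conj_sum I (r : seq I) (P : pred I) (F : I -> R[i]) :
  ((\sum_(i <- r | P i) F i)^*)%C = \sum_(i <- r | P i) ((F i)^*)%C.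
Proof.
apply: (big_morph (fun z : R[i] => (z^*)%C)) => [x y|]; first exact: conjD.
by rewrite /= oppr0.
Qed.

Lemma expiD u v : expi (u + v) = expi u * expi v.
Proof.
rewrite /expi cosD sinD; apply/eqP; rewrite eq_complex /= eqxx /=.
by apply/eqP; ring.
Qed.

Lemma expi0 : expi (0 : R) = 1.
Proof. by rewrite /expi cos0 sin0. Qed.

Lemma expiJ u : ((expi u)^*)%C = expi (- u).
Proof. by rewrite /expi cosN sinN. Qed.

Lemma expiMn u n : expi (n%:R * u) = expi u ^+ n.
Proof.
elim: n => [|n IH]; first by rewrite mul0r expi0.
by rewrite -natr1 mulrDl mul1r expiD IH exprSr.
Qed.

Lemma nsq_expi u : nsq (expi u) = 1.
Proof. by rewrite /nsq /= cos2Dsin2. Qed.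

Lemma expiD2pi u : expi (u + pi *+ 2) = expi u.
Proof. by rewrite /expi sinD2pi cosD2pi. Qed.

Lemma cos_eq1 u : - (pi *+ 2) < u < pi *+ 2 -> cos u = 1 -> u = 0.
Proof.
wlog : u / 0 <= u => [H|u0].
  have [u0|u0] := leP 0 u; first exact: H.
  move=> /andP[u1 u2] cu; apply: oppr_inj; rewrite oppr0; apply: H.
  - by rewrite oppr_ge0 ltW.
  - by rewrite ltrN2 u2 /= ltrNl u1.
  - by rewrite cosN.
move=> /andP[_ u2] cu; apply/eqP; rewrite eq_le u0 andbT leNgt; apply/negP => u1.
have : 0 < sin (u / 2).
  by apply: sin_gt0_pi; move: u2; rewrite mulr2n => u2; apply/andP; split; lra.
have : cos u = 1 - 2 * sin (u/2) ^+ 2.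
  have -> : u = (u/2) *+ 2 by rewrite mulr2n; lra.
  rewrite cos_mulr2n cos2sin2.
  have -> : u / 2 *+ 2 / 2 = u / 2 by rewrite mulr2n; lra.
  rewrite !mulr2n; ring.
rewrite cu => h s0; have : 0 < sin (u/2) ^+ 2 by rewrite exprn_gt0.
lra.
Qed.

Lemma expi_inj u v : - pi <= u < pi -> - pi <= v < pi ->
  expi u = expi v -> u = v.
Proof.
move=> /andP[u1 u2] /andP[v1 v2] [cuv suv]; apply/eqP; rewrite -subr_eq0; apply/eqP.
apply: cos_eq1; last by rewrite cosB cuv suv -!expr2 cos2Dsin2.
by rewrite mulr2n; apply/andP; split; lra.
Qed.

End ComplexBasics.
Arguments expi : simpl never.

(** * Trigonometric polynomials and their integrals *)
Section TrigLists.
Variable R : realType.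
Implicit Types l : seq (R[i] * int).

(** Frequencies may be repeated in the list, so that sums and products of
    trigonometric polynomials are concatenations and pairings of lists. *)
Definition trig l (u : R) : R[i] :=
  \sum_(x <- l) x.1 * expi (x.2%:~R * u).

Definition mulT l l' := [seq (x.1 * y.1, x.2 + y.2) | x <- l, y <- l'].
Definition conjT l := [seq ((x.1^*)%C, - x.2) | x <- l].

Lemma trig_cat l l' u : trig (l ++ l') u = trig l u + trig l' u.
Proof. by rewrite /trig big_cat. Qed.

Lemma trig_mul l l' u : trig (mulT l l') u = trig l u * trig l' u.
Proof.
rewrite /trig big_allpairs_dep /= mulr_suml; apply: eq_bigr => x _.
rewrite mulr_sumr; apply: eq_bigr => y _ /=.
by rewrite intrD mulrDl expiD mulrACA.
Qed.

Lemma trig_conj l u : trig (conjT l) u = ((trig l u)^*)%C.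
Proof.
rewrite /trig big_map conj_sum; apply: eq_bigr => x _.
by rewrite conjM expiJ rmorphN mulNr.
Qed.

Lemma continuous_expi_Re (j : int) :
  continuous (fun u : R => complex.Re (expi (j%:~R * u))).
Proof.
have h : continuous (fun u : R => j%:~R * u) by exact: mulrl_continuous.
move=> u; apply: (@continuous_comp _ _ _ (fun u : R => j%:~R * u) cos).
  exact: h.
exact: continuous_cos.
Qed.

Lemma continuous_expi_Im (j : int) :
  continuous (fun u : R => complex.Im (expi (j%:~R * u))).
Proof.
have h : continuous (fun u : R => j%:~R * u) by exact: mulrl_continuous.
move=> u; apply: (@continuous_comp _ _ _ (fun u : R => j%:~R * u) sin).
  exact: h.
exact: continuous_sin.
Qed.

Lemma continuous_trig l : continuous (fun u : R => complex.Re (trig l u)) /\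
  continuous (fun u : R => complex.Im (trig l u)).
Proof.
elim: l => [|x l [IHr IHi]].
  rewrite /trig; under eq_fun do rewrite big_nil /=.
  under [X in _ /\ continuous X]eq_fun do rewrite big_nil /=.
  by split; exact: cst_continuous.
have hr := @continuous_expi_Re x.2; have hi := @continuous_expi_Im x.2.
rewrite /trig; split.
- under eq_fun do rewrite big_cons cReD cReM.
  move=> u; apply: cvgD; last exact: IHr.
  by apply: cvgB; apply: cvgMl_tmp; [exact: hr|exact: hi].
- under eq_fun do rewrite big_cons cImD cImM.
  move=> u; apply: cvgD; last exact: IHi.
  by apply: cvgD; apply: cvgMl_tmp; [exact: hi|exact: hr].
Qed.

Lemma measurable_trigRe l :
  measurable_fun setT (fun u : measurableTypeR R => complex.Re (trig l u)).
Proof. by apply: continuous_measurable_fun; exact: (continuous_trig l).1. Qed.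
Lemma measurable_trigIm l :
  measurable_fun setT (fun u : measurableTypeR R => complex.Im (trig l u)).
Proof. by apply: continuous_measurable_fun; exact: (continuous_trig l).2. Qed.

Lemma trig_bounded l : exists M, forall u,
  `|complex.Re (trig l u)| <= M /\ `|complex.Im (trig l u)| <= M.
Proof.
exists (\sum_(x <- l) (`|complex.Re x.1| + `|complex.Im x.1|)) => u.
rewrite /trig Re_sum Im_sum; split; apply: le_trans (ler_norm_sum _ _ _) _;
  apply: ler_sum => x _; rewrite ?cReM ?cImM [complex.Re (expi _)]/= [complex.Im (expi _)]/=.
  apply: le_trans (ler_normB _ _) _; rewrite !normrM.
  by apply: lerD; apply: ler_piMr; rewrite // ?cos_max ?sin_max.
apply: le_trans (ler_normD _ _) _; rewrite !normrM.
by apply: lerD; apply: ler_piMr; rewrite // ?cos_max ?sin_max.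
Qed.

Section integral.
Variables (mu : {measure set (measurableTypeR R) -> \bar R})
  (D : set (measurableTypeR R)).
Hypotheses (mD : measurable D) (muD : (mu D < +oo)%E).

Lemma bounded_integrable (f : measurableTypeR R -> R) (M : R) :
  measurable_fun D f -> (forall u, D u -> `|f u| <= M) ->
  mu.-integrable D (EFin \o f).
Proof.
move=> mf bf; apply: measurable_bounded_integrable => //.
exists M; split; first exact: num_real.
by move=> x Mx u Du; exact: le_trans (bf _ Du) (ltW Mx).
Qed.

Lemma integrable_trigRe l :
  mu.-integrable D (fun u => (complex.Re (trig l u))%:E).
Proof.
have [M hM] := trig_bounded l.
apply: (@bounded_integrable _ M) => [|u _]; last exact: (hM u).1.
exact: measurable_funTS (measurable_trigRe l).
Qed.
Lemma integrable_trigIm l :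
  mu.-integrable D (fun u => (complex.Im (trig l u))%:E).
Proof.
have [M hM] := trig_bounded l.
apply: (@bounded_integrable _ M) => [|u _]; last exact: (hM u).2.
exact: measurable_funTS (measurable_trigIm l).
Qed.

Definition fourier (j : int) : R[i] :=
  cRintegral mu D (fun u => expi (j%:~R * u)).

Let trig1 j (u : R) : expi (j%:~R * u) = trig [:: (1, j)] u.
Proof. by rewrite /trig big_seq1 mul1r. Qed.

Lemma cRintegral_trig l :
  cRintegral mu D (trig l) = \sum_(x <- l) x.1 * fourier x.2.
Proof.
elim: l => [|x l IH].
  rewrite big_nil /cRintegral /trig.
  under eq_Rintegral do rewrite big_nil /=.
  under [X in (_ +i* X)%C]eq_Rintegral do rewrite big_nil /=.
  by rewrite !Rintegral_cst // mul0r.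
rewrite big_cons -IH /cRintegral /fourier /cRintegral.
pose a := [:: ((1 : R[i]), x.2)].
have iR := integrable_trigRe a; have iI := integrable_trigIm a.
under eq_Rintegral do rewrite /trig big_cons -/(trig l _) cReD cReM trig1 -/a.
under [X in (_ +i* X)%C]eq_Rintegral do
  rewrite /trig big_cons -/(trig l _) cImD cImM trig1 -/a.
have E1 : (fun u => expi (x.2%:~R * u)) = trig a by apply/funext => u; exact: trig1.
have E2 : (fun u => complex.Re (expi (x.2%:~R * u))) = fun u => complex.Re (trig a u).
  by apply/funext => u; rewrite trig1.
have E3 : (fun u => complex.Im (expi (x.2%:~R * u))) = fun u => complex.Im (trig a u).
  by apply/funext => u; rewrite trig1.
rewrite E2 E3 /=.
have iZ k f : mu.-integrable D (EFin \o f) -> mu.-integrable D (fun u => (k * f u)%:E).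
  by move=> h; under eq_fun do rewrite EFinM; exact: integrableZl.
have iB f g : mu.-integrable D (EFin \o f) -> mu.-integrable D (EFin \o g) ->
    mu.-integrable D (EFin \o (fun u => f u - g u)).
  by move=> h k; apply: eq_integrable (integrableB mD h k).
have iD f g : mu.-integrable D (EFin \o f) -> mu.-integrable D (EFin \o g) ->
    mu.-integrable D (EFin \o (fun u => f u + g u)).
  by move=> h k; apply: eq_integrable (integrableD mD h k).
rewrite RintegralD //; last 2 first.
- by apply: iB; exact: iZ.
- exact: integrable_trigRe.
rewrite RintegralB //; [|exact: iZ|exact: iZ].
rewrite RintegralD //; last 2 first.
- by apply: iD; exact: iZ.
- exact: integrable_trigIm.
rewrite RintegralD //; [|exact: iZ|exact: iZ].
rewrite !RintegralZl //.
by case: (x.1) => a1 a2 /=; apply/eqP; rewrite eq_complex /= !eqxx.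
Qed.

Lemma cRintegral_trigJ l l' :
  cRintegral mu D (fun u => trig l u * ((trig l' u)^*)%C) =
  \sum_(x <- l) \sum_(y <- l') x.1 * (y.1^*)%C * fourier (x.2 - y.2).
Proof.
have -> : (fun u => trig l u * ((trig l' u)^*)%C) = trig (mulT l (conjT l')).
  by apply/funext => u; rewrite trig_mul trig_conj.
rewrite cRintegral_trig big_allpairs_dep; apply: eq_bigr => x _.
by rewrite big_map.
Qed.

Lemma Rintegral_nsq_trig l : \int[mu]_(u in D) nsq (trig l u) =
  complex.Re (\sum_(x <- l) \sum_(y <- l)
                x.1 * (y.1^*)%C * fourier (x.2 - y.2)).
Proof.
by rewrite -cRintegral_trigJ /=; apply: eq_Rintegral => u _; rewrite nsqE.
Qed.

End integral.

Lemma measurable_torus : measurable (torus R).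
Proof. exact: measurable_itv. Qed.

Lemma lebesgue_torus : lebesgue_measure (torus R) = (2 * pi)%:E.
Proof.
rewrite /torus lebesgue_measure_itv /= lte_fin ifT; last by have := pi_gt0 R; lra.
by rewrite -EFinB; congr (_%:E); lra.
Qed.

Lemma sin_intrM_pi (j : int) : sin (j%:~R * pi) = 0 :> R.
Proof.
have h n : sin (n%:R * pi) = 0 :> R.
  have := alternatingn (@sinDpi R) n 0.
  by rewrite add0r sin0 mulr0 mulr_natl.
by case: j => n; [exact: h|rewrite NegzE rmorphN mulNr sinN h oppr0].
Qed.

Lemma lebesgue_fourier (j : int) : fourier lebesgue_measure (torus R) j =
  if j == 0 then ((2 * pi)%:C)%C else 0.
Proof.
have mT := measurable_torus; have fT : (lebesgue_measure (torus R) < +oo)%E.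
  by rewrite lebesgue_torus ltry.
rewrite /fourier /cRintegral; case: eqVneq => [->|jn0].
  under eq_Rintegral do rewrite mul0r expi0 /=.
  under [X in (_ +i* X)%C]eq_Rintegral do rewrite mul0r expi0 /=.
  by rewrite !Rintegral_cst //= lebesgue_torus mul0r mul1r.
have j0 : (j%:~R : R) != 0 by rewrite intr_eq0.
have pp : - pi < pi :> R by have := pi_gt0 R; lra.
(* A derivative of a function taking equal values at both ends integrates to 0. *)
have fin (f F : R -> R) : continuous f -> (forall u : R, is_derive u (1 : R) F (f u)) ->
    F pi = F (- pi) -> \int[lebesgue_measure]_(u in torus R) f u = 0.
  move=> cf dF e; rewrite /Rintegral /torus integral_itv_bndo_bndc; last first.
    apply/measurable_EFinP; apply: measurable_funTS.
    exact: continuous_measurable_fun.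
  rewrite (@continuous_FTC2 _ f F (- pi) pi) //.
  - by rewrite -EFinB e subrr.
  - by apply: continuous_subspaceT => u; exact: cf.
  - split.
    + by move=> u _; have [] := dF u.
    + apply: cvg_at_right_filter; apply: differentiable_continuous.
      by apply/derivable1_diffP; have [] := dF (- pi).
    + apply: cvg_at_left_filter; apply: differentiable_continuous.
      by apply/derivable1_diffP; have [] := dF pi.
  - by move=> u _; rewrite derive1E; have [_ ->] := dF u.
have dl (u : R) : is_derive u (1 : R) (fun u => j%:~R * u) j%:~R.
  by apply: is_derive_eq; rewrite /GRing.scale /= mulr1.
have -> : \int[lebesgue_measure]_(u in torus R)
    complex.Re (expi (j%:~R * u)) = 0.
  apply: (fin _ (fun u => (j%:~R)^-1 * sin (j%:~R * u))).
  - exact: continuous_expi_Re.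
  - move=> u; apply: is_derive_eq; rewrite /GRing.scale /=.
    by rewrite mulrCA mulVf ?mulr1 //.
  - by rewrite !mulrN sinN sin_intrM_pi oppr0.
have -> : \int[lebesgue_measure]_(u in torus R)
    complex.Im (expi (j%:~R * u)) = 0.
  apply: (fin _ (fun u => - (j%:~R)^-1 * cos (j%:~R * u))).
  - exact: continuous_expi_Im.
  - move=> u; apply: is_derive_eq; rewrite /GRing.scale /=.
    by field.
  - by rewrite mulrN cosN.
by [].
Qed.

End TrigLists.

(** * Bounded pointwise limits *)
Section PointwiseClosure.
Variables (R : realType) (D : set R) (A : set (R -> R)).

(** The Baire functions generated by [A] on [D]. Each limit comes with a uniform
    bound, which makes bounded convergence available for every finite measure at
    once. *)
Inductive pclosure : (R -> R) -> Prop :=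
| pclosure_base f of A f : pclosure f
| pclosure_lim F f (M : R) of
    (forall n : nat, pclosure (F n)) &
    (forall n u, D u -> `|F n u| <= M) &
    (forall u, D u -> (fun n => F n u) @ \oo --> f u) : pclosure f.

Hypothesis Abounded : forall f, A f -> exists M : R, forall u, D u -> `|f u| <= M.
Hypothesis Acst : forall c, A (fun=> c).
Hypothesis Aadd : forall f g, A f -> A g -> A (fun u => f u + g u).
Hypothesis Amul : forall f g, A f -> A g -> A (fun u => f u * g u).

Lemma pclosure_bounded f : pclosure f -> exists M : R, forall u, D u -> `|f u| <= M.
Proof.
case=> [{}f /Abounded//|F {}f M _ bF cF]; exists M => u Du.
apply: (cvgr_to_le (cvg_norm (cF _ Du))).
by near=> n; exact: bF.
Unshelve. all: by end_near.
Qed.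

Lemma pclosure_ext f g : pclosure f -> (forall u, D u -> f u = g u) -> pclosure g.
Proof.
move=> cf fg; have [M bM] := pclosure_bounded cf.
apply: (@pclosure_lim (fun=> f) g M) => // u Du; rewrite fg //; exact: cvg_cst.
Qed.

(** Limits are taken in one argument at a time: first [f] is fixed in [A] and
    [g] varies over the closure, then [g] is fixed and [f] varies. Continuity in
    each argument separately is therefore enough. *)
Lemma pclosure_op (op : R -> R -> R) :
  (forall f g, A f -> A g -> A (fun u => op (f u) (g u))) ->
  (forall x, continuous (op x)) -> (forall y, continuous (op^~ y)) ->
  (forall M N, exists K, forall x y, `|x| <= M -> `|y| <= N -> `|op x y| <= K) ->
  forall f g, pclosure f -> pclosure g -> pclosure (fun u => op (f u) (g u)).
Proof.
move=> Aop cl cr bop f g cf; elim: cf g => [{}f Af g|F {}f M _ IH bF cF g cg].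
- elim=> [{}g Ag|G {}g N cG IH bG cvG]; first exact/pclosure_base/Aop.
  have [M bM] := Abounded Af; have [K bK] := bop M N.
  apply: (@pclosure_lim (fun n u => op (f u) (G n u)) _ K) => // [n u Du|u Du].
    by apply: bK; [exact: bM|exact: bG].
  exact: (@continuous_cvg _ _ _ _ _ (fun n => G n u) (op (f u)) (g u) (cl _ _) (cvG _ Du)).
- have [N bN] := pclosure_bounded cg; have [K bK] := bop M N.
  apply: (@pclosure_lim (fun n u => op (F n u) (g u)) _ K) => [n|n u Du|u Du].
  + exact: IH.
  + by apply: bK; [exact: bF|exact: bN].
  + exact: (@continuous_cvg _ _ _ _ _ (fun n => F n u) (op^~ (g u)) (f u) (cr _ _) (cF _ Du)).
Qed.

Lemma pclosureD f g : pclosure f -> pclosure g -> pclosure (fun u => f u + g u).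
Proof.
apply: pclosure_op => // [x y|y x|M N].
- by apply: cvgD; [exact: cvg_cst|exact: cvg_id].
- by apply: cvgD; [exact: cvg_id|exact: cvg_cst].
- exists (M + N) => x y xM yN; apply: le_trans (ler_normD _ _) _; exact: lerD.
Qed.

Lemma pclosureM f g : pclosure f -> pclosure g -> pclosure (fun u => f u * g u).
Proof.
apply: pclosure_op => // [x|y|M N].
- exact: mulrl_continuous.
- exact: mulrr_continuous.
- exists (M * N) => x y xM yN; rewrite normrM; exact: ler_pM.
Qed.

Lemma pclosure_cst c : pclosure (fun=> c).
Proof. exact/pclosure_base/Acst. Qed.

(** On [-1, 1] the iterates of this odd polynomial converge to the sign: 0, 1 and
    -1 are fixed, and a positive start is pushed up to 1. This produces
    discontinuous functions from algebra operations and limits only. *)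
Let step (x : R) := x * (3 - x * x) / 2.

Let step_range x : `|x| <= 1 -> `|step x| <= 1.
Proof.
rewrite !ler_norml => /andP[x1 x2].
have e1 : 1 - step x = (1 - x) ^+ 2 * ((2 + x) / 2) by rewrite /step; field.
have e2 : 1 + step x = (1 + x) ^+ 2 * ((2 - x) / 2) by rewrite /step; field.
have : 0 <= 1 - step x by rewrite e1 mulr_ge0 ?sqr_ge0 //; lra.
have : 0 <= 1 + step x by rewrite e2 mulr_ge0 ?sqr_ge0 //; lra.
by move=> h1 h2; apply/andP; split; lra.
Qed.

Let iter_range n x : `|x| <= 1 -> `|iter n step x| <= 1.
Proof. by move=> x1; elim: n => // n IH; rewrite iterS; exact: step_range. Qed.

Let iter_pos n x : 0 < x -> x <= 1 ->
  [/\ x <= iter n step x, iter n step x <= 1 &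
   1 - iter n step x <= (1 - x / 2) ^+ n].
Proof.
move=> x0 x1; elim: n => [|n [IH1 IH2 IH3]]; first by rewrite expr0 /=; split => //; lra.
rewrite iterS exprS; set y := iter n step x in IH1 IH2 IH3 *.
have h0 : y <= step y.
  have -> : step y = y + y * ((1 - y) * (1 + y) / 2) by rewrite /step; field.
  by rewrite lerDl mulr_ge0 //; [lra|rewrite divr_ge0 // mulr_ge0; lra].
have h1 : x <= step y by lra.
have h2 : step y <= 1.
  have := @step_range y; rewrite ger0_norm; last by lra.
  by move/(_ IH2)/(le_trans (ler_norm _)).
split => //.
(* The new error is the old one times a factor at most [1 - x / 2]. *)
have -> : 1 - step y = (1 - y) * (1 - y / 2 * (1 + y)) by rewrite /step; field.
have : 0 <= 1 - y by lra.
have : 1 - y / 2 * (1 + y) <= 1 - x / 2 by nra.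
have : 0 <= 1 - y / 2 * (1 + y) by nra.
move=> a b c; rewrite mulrC; apply: ler_pM => //.
Qed.

Let iter_neg n x : iter n step (- x) = - iter n step x.
Proof. by elim: n => // n IH; rewrite !iterS IH /step; field. Qed.

Let iter_cvg x : `|x| <= 1 -> iter n step x @[n --> \oo] --> Num.sg x.
Proof.
have pos (y : R) : 0 < y -> y <= 1 -> iter n step y @[n --> \oo] --> (1 : R).
  move=> y0 y1; rewrite -[X in _ --> X]subr0.
  under eq_fun do rewrite -[iter _ _ _](subKr 1).
  apply: cvgB; first exact: cvg_cst.
  apply: (@squeeze_cvgr _ _ _ _ (fun=> 0) (fun n => (1 - y / 2) ^+ n)).
  - near=> n; have [h1 h2 h3] := iter_pos n y0 y1.
    by rewrite h3 andbT subr_ge0.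
  - exact: cvg_cst.
  - apply: cvg_expr.
    have [h1 h2] : 0 <= 1 - y / 2 /\ 1 - y / 2 < 1 by split; lra.
    by rewrite ger0_norm.
move=> x1; have [x0|x0|->] := ltgtP x 0.
- rewrite ltr0_sg //.
  have -> : (fun n => iter n step x) = (fun n => - iter n step (- x)).
    by apply/funext => n; rewrite iter_neg opprK.
  apply: cvgN; apply: pos; first by lra.
  by move: x1; rewrite ltr0_norm.
- by rewrite gtr0_sg //; apply: pos => //; move: x1; rewrite gtr0_norm.
- rewrite sgr0; under eq_fun => n.
    rewrite (_ : iter n step 0 = 0); first over.
    by elim: n => // n IH; rewrite iterS IH /step !mul0r.
  exact: cvg_cst.
Unshelve. all: by end_near.
Qed.

Lemma pclosure_sg f : pclosure f -> pclosure (fun u => Num.sg (f u)).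
Proof.
move=> cf; have [M bM] := pclosure_bounded cf.
pose K := `|M| + 1; have K0 : 0 < K by rewrite ltr_wpDl.
have bK u : D u -> `|K^-1 * f u| <= 1.
  move=> Du; rewrite normrM gtr0_norm ?invr_gt0 // ler_pdivrMl // mulr1.
  by apply: le_trans (bM _ Du) _; apply: le_trans (ler_norm M) _; rewrite lerDl.
apply: (@pclosure_lim (fun n u => iter n step (K^-1 * f u)) _ 1).
- elim=> [|n IH] /=; first exact/pclosureM/cf/pclosure_cst.
  rewrite /step.
  apply: (pclosureM _ (pclosure_cst _)); apply: (pclosureM IH).
  apply: (pclosureD (pclosure_cst _)).
  under eq_fun do rewrite -mulN1r.
  apply: (pclosureM (pclosure_cst _)); exact: pclosureM.
- by move=> n u Du; apply/iter_range/bK.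
- move=> u Du; have := iter_cvg (bK _ Du).
  by rewrite sgrM gtr0_sg ?invr_gt0 // mul1r.
Qed.

Definition pclset (B : set R) := pclosure (\1_B : R -> R).

Lemma pclsetC B : pclset B -> pclset (~` B).
Proof.
move=> cB; apply: (@pclosure_ext (fun u => 1 + (-1) * \1_B u)).
  by apply: (pclosureD (pclosure_cst _)); apply: (pclosureM (pclosure_cst _)).
move=> u _; rewrite !indicE in_setC; case: (u \in B) => /=; lra.
Qed.

Lemma pclsetI B C : pclset B -> pclset C -> pclset (B `&` C).
Proof.
by move=> cB cC; apply: (pclosure_ext (pclosureM cB cC)) => u _; rewrite indicI.
Qed.

Lemma pclsetU B C : pclset B -> pclset C -> pclset (B `|` C).
Proof.
move=> cB cC; rewrite -[B `|` C]setCK setCU.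
by apply: pclsetC; apply: pclsetI; exact: pclsetC.
Qed.

Lemma pclset0 : pclset set0.
Proof. by rewrite /pclset indic0; exact: pclosure_cst. Qed.

Lemma pclset_bigcup (F : (set R)^nat) : (forall n, pclset (F n)) -> pclset (\bigcup_n F n).
Proof.
move=> pF; pose G n := \big[setU/set0]_(i < n) F i.
have pG n : pclset (G n).
  by rewrite /G; elim/big_ind : _ => //; [exact: pclset0|exact: pclsetU].
have GP k u : G k u <-> exists2 n, (n < k)%N & F n u.
  by rewrite /G -bigcup_mkord; split => -[n nk Fn]; exists n.
apply: (@pclosure_lim (fun n => \1_(G n)) _ 1) => // [n u _|u _].
  by rewrite indicE ger0_norm // lern1 leq_b1.
have [[n _ Fn]|nF] := pselect ((\bigcup_n F n) u).
  apply: cvg_near_cst; near=> k; rewrite !indicE (mem_set (_ : G k u)) ?(mem_set (_ : (\bigcup_n F n) u)) //.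
    by exists n.
  have nk : (n < k)%N by near: k; exists n.+1.
  by apply/GP; exists n.
rewrite indicE memNset //; apply: cvg_near_cst; near=> k.
rewrite indicE memNset //= => /GP[n _ Fn]; apply: nF; by exists n.
Unshelve. all: by end_near.
Qed.

Lemma pclset_gt0 f : pclosure f -> pclset [set u | 0 < f u].
Proof.
move=> /pclosure_sg csg.
apply: (@pclosure_ext (fun u => 2^-1 * (Num.sg (f u) + Num.sg (f u) * Num.sg (f u)))).
  by apply: (pclosureM (pclosure_cst _)); apply: (pclosureD csg); exact: pclosureM.
move=> u _; rewrite indicE; have [f0|f0|f0] := ltgtP (f u) 0.
- by rewrite ltr0_sg // memNset /=; [lra|rewrite lt_gtF].
- by rewrite gtr0_sg // mem_set //=; lra.
- by rewrite f0 sgr0 memNset /= ?f0 ?ltxx //; lra.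
Qed.

Lemma pclset_smallest (G : set (set R)) : G `<=` pclset -> <<s G >> `<=` pclset.
Proof.
apply: smallest_sub; split; first exact: pclset0.
- by move=> B; rewrite setTD; exact: pclsetC.
- exact: pclset_bigcup.
Qed.

Import HBNNSimple.

(** Once indicators are available, so are simple functions; those approximating
    [g + M >= 0] from below stay bounded. *)
Lemma pclosure_measurable (g : measurableTypeR R -> R) (M : R) :
  (forall B : set (measurableTypeR R), measurable B -> pclset B) ->
  measurable_fun setT g -> (forall u, `|g u| <= M) -> pclosure g.
Proof.
move=> pB mg bg.
have pcl_sum (I : eqType) (s : seq I) (h : I -> R -> R) :
    (forall i, pclosure (h i)) -> pclosure (fun u => \sum_(i <- s) h i u).
  move=> ch; elim: s => [|i s IH].
    by under eq_fun do rewrite big_nil; exact: pclosure_cst.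
  by under eq_fun do rewrite big_cons; exact: pclosureD.
have pcl_nnsfun (h : {nnsfun (measurableTypeR R) >-> R}) : pclosure h.
  pose F (u : R) : R := \sum_(r <- finmap.enum_fset (fset_set (range h))) r * \1_(h @^-1` [set r]) u.
  have cF : pclosure F.
    apply: (pcl_sum _ _ (fun r u => r * \1_(h @^-1` [set r]) u)) => r.
    apply: (pclosureM (pclosure_cst _)); exact: pB.
  apply: (pclosure_ext cF) => u _.
  by rewrite /F (fimfunE h) fsbig_finite.
pose f u := (g u + M)%:E.
have f0 u : setT u -> (0 <= f u)%E.
  move=> _; rewrite lee_fin; have := bg u; rewrite ler_norml; lra.
have mf : measurable_fun (setT : set (measurableTypeR R)) f.
  apply/measurable_EFinP; exact: measurable_funD.
pose h := nnsfun_approx (@measurableT _ _) mf.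
apply: (pclosure_ext (f := fun u => (g u + M) + - M)); last by move=> u _; rewrite addrK.
apply: (pclosureD _ (pclosure_cst _)).
apply: (@pclosure_lim (fun n => h n) _ (M + M)) => [n|n u _|u _].
- exact: pcl_nnsfun.
- rewrite ger0_norm //.
  have := le_approx n f0 (Logic.I : setT u).
  rewrite /h nnsfun_approxE lee_fin => /le_trans; apply.
  by rewrite lerD2r; have := bg u; rewrite ler_norml => /andP[].
- have := cvg_nnsfun_approx (@measurableT _ _) mf f0 (Logic.I : setT u).
  by move/fine_cvgP => [].
Qed.

End PointwiseClosure.
Section TrigDense.
Variable R : realType.

Definition trigreal : set (R -> R) :=
  [set f | exists l, f = fun u => complex.Re (trig l u)].

Let Abounded f : trigreal f ->
  exists M : R, forall u, torus R u -> `|f u| <= M.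
Proof.
move=> [l ->]; have [M hM] := trig_bounded l.
by exists M => u _; exact: (hM u).1.
Qed.

Let trig_single (z : R[i]) (j : int) (u : R) :
  trig [:: (z, j)] u = z * expi (j%:~R * u).
Proof. by rewrite /trig big_seq1. Qed.

Let Acst c : trigreal (fun=> c).
Proof.
exists [:: ((c%:C)%C, 0)]; apply/funext => u.
by rewrite trig_single mul0r expi0 mulr1.
Qed.

Let Aadd f g : trigreal f -> trigreal g -> trigreal (fun u => f u + g u).
Proof.
move=> [l ->] [l' ->]; exists (l ++ l'); apply/funext => u.
by rewrite trig_cat cReD.
Qed.

Let Amul f g : trigreal f -> trigreal g -> trigreal (fun u => f u * g u).
Proof.
move=> [l ->] [l' ->].
(* The product of two real parts is the real part of [z * (w + conj w) / 2]. *)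
exists (mulT [:: (((2^-1)%:C)%C, 0)] (mulT l (l' ++ conjT l'))).
apply/funext => u.
rewrite !trig_mul trig_single mul0r expi0 mulr1 trig_cat trig_conj.
rewrite !cReM cReD cImD cReJ cImJ /=; by field.
Qed.

Let Asin : trigreal (@sin R).
Proof.
exists [:: ((0 +i* (-1))%C, 1)]; apply/funext => u.
by rewrite trig_single mul1r cReM /=; ring.
Qed.

Let Acos : trigreal (@cos R).
Proof.
exists [:: (1, 1)]; apply/funext => u.
by rewrite trig_single !mul1r.
Qed.

Local Notation pcl := (pclosure (torus R) trigreal).
Local Notation pst := (pclset (torus R) trigreal).

Let pst_ext (B C : set R) : pst B ->
  (forall u : R, (torus R : set R) u -> (B u <-> C u)) -> pst C.
Proof.
move=> cB BC; apply: (pclosure_ext Abounded cB) => u Tu.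
by rewrite !indicE; congr ((_ : bool)%:R); apply/idP/idP; rewrite !inE; move/(BC _ Tu).
Qed.

Let pst_gt (f : R -> R) c : trigreal f -> pst [set u | c < f u].
Proof.
move=> Af; apply: (pst_ext (B := [set u | 0 < f u + - c])).
  apply: (pclset_gt0 Abounded Acst Aadd Amul).
  by apply: pclosure_base; apply: Aadd.
by move=> u _ /=; rewrite subr_gt0.
Qed.

Let pst_setC B : pst B -> pst (~` B).
Proof. exact: (pclsetC Abounded Acst Aadd Amul). Qed.
Let pst_setI B C : pst B -> pst C -> pst (B `&` C).
Proof. exact: (pclsetI Abounded Amul). Qed.
Let pst_setU B C : pst B -> pst C -> pst (B `|` C).
Proof. exact: (pclsetU Abounded Acst Aadd Amul). Qed.

(* Inside the torus the upper half circle and the level sets of cos describe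
   all half lines. *)
Let pst_itv x : pst `]x, +oo[%classic.
Proof.
have pi0 := pi_gt0 R.
have upper : pst [set u | 0 <= u].
  apply: (pst_ext (pst_setI (pst_setC (pst_gt 0 (Aadd (Acst 0) (Amul (Acst (-1)) Asin))))
     (pst_gt (-1) Acos))) => u /=; rewrite /torus /= in_itv /= => /andP[u1 u2].
  rewrite add0r mulN1r; split.
    move=> [/negP]; rewrite -leNgt oppr_le0 => s0 c0.
    rewrite leNgt; apply/negP => u0.
    have un : u != - pi by apply: contraTneq c0 => ->; rewrite cosN cospi ltxx.
    have : 0 < sin (- u).
      by apply: sin_gt0_pi; rewrite oppr_gt0 u0 ltrNl lt_neqAle eq_sym un u1.
    by rewrite sinN; lra.
  move=> u0; split.
    apply/negP; rewrite -leNgt oppr_le0; apply: sin_ge0_pi; lra.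
  rewrite -cospi ltr_cos ?in_itv /=; lra.
have [xpi|xpi] := leP pi x.
  apply: (pst_ext (pclset0 (torus R) Acst)) => u.
  rewrite /torus /= !in_itv /= andbT => /andP[u1 u2]; split => //.
  by lra.
have [xpi'|xpi'] := ltP x (- pi).
  apply: (pst_ext (pst_setC (pclset0 (torus R) Acst))) => u.
  rewrite /torus /= !in_itv /= andbT => /andP[u1 u2].
  by split => _; [lra|move=> []].
have [x0|x0] := leP 0 x.
  have h := pst_setI upper (pst_gt (- cos x) (Amul (Acst (-1)) Acos)).
 apply: (pst_ext h).
  move=> u /=; rewrite /torus /= !in_itv /= andbT mulN1r ltrN2 => /andP[u1 u2].
  split=> [[u0]|xu]; first by rewrite ltr_cos // in_itv /=; lra.
  have u0 : 0 <= u by lra.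
  by split => //; rewrite ltr_cos // in_itv /=; lra.
have h := pst_setU upper (pst_gt (cos x) Acos).
apply: (pst_ext h).
move=> u /=; rewrite /torus /= !in_itv /= andbT => /andP[u1 u2].
have [u0|u0] := leP 0 u; first by split=> _; [lra|left].
rewrite -(cosN u) -(cosN x) ltr_cos ?in_itv /=; [|lra|lra].
rewrite ltrN2; split=> [[|]//|xu]; by right.
Qed.

(** This takes the place of the density of trigonometric polynomials in a space
    of functions: it serves the spectral measure and Lebesgue measure together. *)
Theorem bounded_measurable_pclosure (g : measurableTypeR R -> R) (M : R) :
  measurable_fun setT g -> (forall u, `|g u| <= M) -> pcl g.
Proof.
apply: (pclosure_measurable Abounded Acst Aadd Amul) => B.
rewrite RGenOInfty.measurableE.
apply: (pclset_smallest Abounded Acst Aadd Amul) => _ [x ->].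
exact: pst_itv.
Qed.

End TrigDense.

(** * Integration against the spectral measure *)
Section WeightedMeasure.
Context d (T : measurableType d) (R : realType).
Variables (mu : {measure set T -> \bar R}) (w : T -> \bar R).
Hypotheses (mw : measurable_fun setT w) (w0 : forall x, (0 <= w x)%E).

Definition weighted of measurable_fun setT w & (forall x, (0 <= w x)%E) :=
  fun A : set T => (\int[mu]_(x in A) w x)%E.

Local Notation wmu := (weighted mw w0).

Let wmu0 : wmu set0 = 0%E. Proof. exact: integral_set0. Qed.
Let wmu_ge0 A : (0 <= wmu A)%E. Proof. by apply: integral_ge0 => x _; exact: w0. Qed.
Let wmu_sigma : semi_sigma_additive wmu.
Proof. exact: semi_sigma_additive_nng_induced. Qed.

HB.instance Definition _ := isMeasure.Build _ _ _ wmu wmu0 wmu_ge0 wmu_sigma.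

Import HBNNSimple.
Local Open Scope ereal_scope.

Lemma integral_weighted (f : T -> R) : (forall x, w x \is a fin_num) ->
  measurable_fun setT f -> (forall x, 0 <= f x)%R ->
  \int[wmu]_x (f x)%:E = \int[mu]_x ((f x)%:E * w x).
Proof.
move=> wfin mf f0; pose F x := (f x)%:E.
have mF : measurable_fun setT F by exact/measurable_EFinP.
have F0 x : setT x -> 0 <= F x by rewrite lee_fin.
pose h := nnsfun_approx measurableT mF.
have mh n : measurable_fun setT (EFin \o h n) by exact/measurable_EFinP.
have nd x : {homo (fun n => (h n x)%:E) : a b / (a <= b)%N >-> a <= b}.
  by move=> a b ab; rewrite lee_fin; exact/lefP/nd_nnsfun_approx.
have cv x : (h n x)%:E @[n --> \oo] --> F x by exact: cvg_nnsfun_approx.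
have -> : \int[wmu]_x (f x)%:E = limn (fun n => \int[wmu]_x (EFin \o h n) x).
  rewrite -monotone_convergence //.
    by apply: eq_integral => x _; apply/esym/cvg_lim => //; exact: cv.
    by move=> n x _; rewrite lee_fin.
  by move=> x _; exact: nd.
have -> : \int[mu]_x ((f x)%:E * w x) =
    limn (fun n => \int[mu]_x ((EFin \o h n) x * w x)).
  rewrite -monotone_convergence //.
  - apply: eq_integral => x _; apply/esym/cvg_lim => //; apply: cvgeZr => //.
    exact: cv.
  - by move=> n; exact: emeasurable_funM.
  - by move=> n x _; rewrite mule_ge0 ?lee_fin.
  - by move=> x _ a b ab; rewrite lee_wpmul2r //; exact: nd.
congr (limn _); apply/funext => n.
rewrite integralT_nnsfun sintegralE.
transitivity (\int[mu]_x (\sum_(y \in range (h n))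
    (y * \1_(h n @^-1` [set y]) x)%:E * w x)); last first.
  apply: eq_integral => x _.
  rewrite -ge0_mule_fsuml => [|y]; last exact: nnfun_muleindic_ge0.
  by rewrite fsumEFin // -(fimfunE _ x).
have mi r : measurable_fun setT (fun x => (r * \1_(h n @^-1` [set r]) x)%:E).
  by apply/measurable_EFinP; apply: measurable_funM.
rewrite ge0_integral_fsum//; last 2 first.
  - by move=> y; apply: emeasurable_funM => //.
  - by move=> m y Ey; rewrite mule_ge0 // nnfun_muleindic_ge0.
apply: eq_fsbigr => r rhn.
have r0 : (0 <= r)%R by move: rhn; rewrite inE => -[t _ <-].
under eq_integral do rewrite EFinM -muleA.
rewrite ge0_integralZl_EFin //; last 2 first.
- by move=> x _; rewrite mule_ge0 // lee_fin.
- by apply: emeasurable_funM => //; exact/measurable_EFinP.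
congr (_ * _); rewrite /= /weighted integral_mkcond.
by apply: eq_integral => x _; rewrite patchE indicE; case: (x \in _);
  rewrite /= ?mul1e ?mul0e.
Qed.

End WeightedMeasure.

Section LebesgueDecomposition.
Context (R : realType).
Variables (S nu : {measure set (measurableTypeR R) -> \bar R})
  (s : measurableTypeR R -> R).
Hypotheses (ms : measurable_fun setT s) (s0 : forall u, 0 <= s u).
Hypothesis Sdec : forall B, measurable B ->
  S B = (\int[lebesgue_measure]_(u in B `&` torus R) (s u)%:E + nu B)%E.
Local Open Scope ereal_scope.

Lemma integral_lebesgue_decomposition (g : measurableTypeR R -> R) :
  measurable_fun setT g -> (forall u, 0 <= g u)%R ->
  \int[S]_u (g u)%:E =
  \int[lebesgue_measure]_(u in torus R) (g u * s u)%:E + \int[nu]_u (g u)%:E.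
Proof.
move=> mg g0; pose w := (EFin \o s) \_ (torus R).
have mT := @measurable_torus R.
have mw : measurable_fun setT w.
  apply/(measurable_restrictT _ mT); apply: measurable_funTS.
  exact/measurable_EFinP.
have w0 x : 0 <= w x by rewrite /w; apply: erestrict_ge0 => y _; rewrite lee_fin.
rewrite (@eq_measure_integral _ _ _ _ (measure_add (weighted lebesgue_measure mw w0) nu)); last first.
  move=> A mA _; rewrite Sdec // [RHS]measure_addE; congr (_ + _).
  by rewrite /= /weighted -integral_mkcondr.
rewrite ge0_integral_measure_add //; last 2 first.
- by move=> x _; rewrite lee_fin.
- by apply/measurable_EFinP.
have wfin x : w x \is a fin_num.
  by rewrite /w patchE; case: ifP.
congr (_ + _); rewrite integral_weighted // [RHS]integral_mkcond.
apply: eq_integral => x _; rewrite /w !patchE; case: ifP => _; last by rewrite mule0.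
by rewrite EFinM.
Qed.

End LebesgueDecomposition.
Section TorusDecomposition.
Context (R : realType).
Variables (S : {finite_measure set (measurableTypeR R) -> \bar R})
  (s : measurableTypeR R -> R).
Hypothesis s_density : is_ac_density S s.
Local Open Scope ereal_scope.
Let mT := @measurable_torus R.

(** [N] is the null set that carries the singular part: a function vanishing on
    it is integrated by [S] against the density only. *)
Lemma torus_decomposition : exists2 N : set (measurableTypeR R), measurable N &
  lebesgue_measure N = 0 /\
  forall g : measurableTypeR R -> R, measurable_fun setT g ->
  (forall u, 0 <= g u)%R ->
  [/\ \int[lebesgue_measure]_(u in torus R) (g u * s u)%:E <=
      \int[S]_(u in torus R) (g u)%:E &
      (forall u, N u -> g u = 0%R) ->
      \int[S]_(u in torus R) (g u)%:E =
      \int[lebesgue_measure]_(u in torus R) (g u * s u)%:E].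
Proof.
have [ms s0 _ [nu [N mN [N0 nuN]] Sdec]] := s_density.
exists N => //; split => // g mg g0.
pose gT u : R := (g u * \1_(torus R) u)%R.
have mgT : measurable_fun setT gT.
  by apply: measurable_funM => //; exact: measurable_indic.
have gT0 u : (0 <= gT u)%R by rewrite /gT mulr_ge0.
have e1 (mu : {measure set (measurableTypeR R) -> \bar R}) :
    \int[mu]_(u in torus R) (g u)%:E = \int[mu]_u (gT u)%:E.
  rewrite integral_mkcond; apply: eq_integral => u _.
  by rewrite patchE /gT indicE; case: (u \in _); rewrite ?mulr1 ?mulr0.
have e2 : \int[lebesgue_measure]_(u in torus R) (gT u * s u)%:E =
    \int[lebesgue_measure]_(u in torus R) (g u * s u)%:E.
  by apply: eq_integral => u uT; rewrite /gT indicE uT mulr1.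
have -> : \int[S]_(u in torus R) (g u)%:E =
    \int[lebesgue_measure]_(u in torus R) (g u * s u)%:E + \int[nu]_u (gT u)%:E.
  by rewrite e1 -e2; apply: integral_lebesgue_decomposition.
split.
  by rewrite leeDl // integral_ge0 // => u _; rewrite lee_fin.
move=> gN; rewrite [X in _ + X](_ : _ = 0) ?adde0 //.
rewrite -(setvU N) ge0_integral_setU //; last 4 first.
- exact: measurableC.
- by apply: measurable_funTS; exact/measurable_EFinP.
- by move=> u _; rewrite lee_fin.
- by rewrite disj_set2E setICl.
rewrite null_set_integral //; [|exact: measurableC|].
  rewrite add0e; under eq_integral => u uN.
    rewrite /gT gN ?mul0r; last by rewrite inE in uN.
    over.
  exact: integral0.
by apply: measurable_funTS; exact/measurable_EFinP.
Qed.

Lemma measurable_inv_density : measurable_fun setT (inv_density s).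
Proof.
have [ms s0 _ _] := s_density.
have -> : inv_density s = fun u => if s u == 0%R then +oo else ((s u)^-1)%:E.
  by apply/funext => u.
apply: measurable_fun_ifT => //.
  by apply: measurable_fun_eqr => //; exact: measurable_cst.
apply/measurable_EFinP.
under eq_fun do rewrite -powR_inv1 //.
exact: (measurableT_comp (measurable_powR _)).
Qed.

Lemma inv_density_ge0 u : 0 <= inv_density s u.
Proof.
have [ms s0 _ _] := s_density.
rewrite /inv_density /inve; case: ifP => // _.
by rewrite lee_fin invr_ge0.
Qed.

End TorusDecomposition.

(** * A functional separating a vector from a subspace *)
Section SeparatingFunctional.
Variables (R : realType) (V : lmodType R) (B : V -> V -> R) (T W : set V).
Hypothesis T_lin : forall a x y, T x -> T y -> T (a *: x + y).
Hypothesis W_lin : forall a x y, W x -> W y -> W (a *: x + y).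
Hypothesis W0 : W 0.
Hypothesis WT : W `<=` T.
Hypothesis Bsym : forall x y, T x -> T y -> B x y = B y x.
Hypothesis Blin : forall a x y z, T x -> T y -> T z ->
  B (a *: x + y) z = a * B x z + B y z.
Hypothesis Bge0 : forall x, T x -> 0 <= B x x.

Let T0 : T 0. Proof. exact: WT. Qed.

Let TZ a x : T x -> T (a *: x).
Proof. by move=> Tx; rewrite -[_ *: _]addr0; apply: T_lin. Qed.

Let WZ a x : W x -> W (a *: x).
Proof. by move=> Wx; rewrite -[_ *: _]addr0; apply: W_lin. Qed.

Let B0 z : T z -> B 0 z = 0.
Proof. by move=> Tz; have := @Blin 1 0 0 z T0 T0 Tz; rewrite scaler0 addr0; lra. Qed.

Let BZ a x z : T x -> T z -> B (a *: x) z = a * B x z.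
Proof. by move=> Tx Tz; rewrite -[_ *: _]addr0 Blin // B0 // addr0. Qed.

Let BlinR a x y z : T x -> T y -> T z ->
  B z (a *: x + y) = a * B z x + B z y.
Proof.
by move=> Tx Ty Tz; rewrite Bsym ?Blin //; [rewrite !(Bsym Tz)|apply: T_lin].
Qed.

Let Bexpand a b x y : T x -> T y ->
  B (a *: x + b *: y) (a *: x + b *: y) =
    a ^+ 2 * B x x + 2 * a * b * B x y + b ^+ 2 * B y y.
Proof.
move=> Tx Ty; have Tby := TZ b Ty; have Tax := TZ a Tx.
rewrite Blin ?BlinR //; last exact: T_lin.
rewrite !(Bsym _ Tby) // !BZ // (Bsym _ Tby) // BZ // (Bsym Ty Tx); ring.
Qed.

Lemma discriminant_le (a b c : R) : 0 <= a -> 0 <= c ->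
  (forall t, 0 <= t ^+ 2 * a + 2 * t * b + c) -> b ^+ 2 <= a * c.
Proof.
move=> a0 c0 H; have [a_0|an0] := eqVneq a 0.
  rewrite a_0 mul0r; suff -> : b = 0 by rewrite expr0n.
  apply/eqP; apply: contraT => bn0.
  have := H (- (c + 1) / (2 * b)); rewrite a_0 mulr0 add0r.
  have -> : 2 * (- (c + 1) / (2 * b)) * b = - (c + 1) by field.
  by move=> h; exfalso; lra.
have ap : 0 < a by rewrite lt0r an0.
have := H (- b / a).
have -> : (- b / a) ^+ 2 * a + 2 * (- b / a) * b + c = (a * c - b ^+ 2) / a.
  by field.
by rewrite pmulr_lge0 ?invr_gt0 // subr_ge0.
Qed.

Lemma form_cauchy_schwarz x y : T x -> T y -> B x y ^+ 2 <= B x x * B y y.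
Proof.
move=> Tx Ty; apply: discriminant_le; rewrite ?Bge0 // => t.
have := Bge0 (T_lin t Tx (TZ 1 Ty)); rewrite Bexpand //.
by rewrite mulr1 expr1n mul1r.
Qed.

Variables (g : V) (delta : R).
Hypothesis Tg : T g.
Hypothesis delta0 : 0 < delta.
Hypothesis gfar : forall w, W w -> delta <= B (g - w) (g - w).

Let dist2 := inf [set B (g - w) (g - w) | w in W].

Let gW w : W w -> T (g - w).
Proof. by move=> Ww; rewrite addrC -scaleN1r; apply: T_lin => //; apply: WT. Qed.

Let dist2_le w : W w -> dist2 <= B (g - w) (g - w).
Proof.
move=> Ww; apply: ge_inf; last by exists w.
by exists delta => _ [v Wv <-]; exact: gfar.
Qed.

Let dist2_gt0 : 0 < dist2.
Proof.
apply: (lt_le_trans delta0); apply: lb_le_inf.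
  by exists (B (g - 0) (g - 0)), 0.
by move=> _ [v Wv <-]; exact: gfar.
Qed.

Let near_min (n : nat) :
  {w | W w & B (g - w) (g - w) <= dist2 + n.+1%:R^-1}.
Proof.
apply: cid2.
have hi : has_inf [set B (g - w) (g - w) | w in W].
  split; first by exists (B (g - 0) (g - 0)), 0.
  by exists delta => _ [v Wv <-]; exact: gfar.
have n0 : 0 < (n.+1%:R^-1 : R) by rewrite invr_gt0.
have [_ [w Ww <-] lt] := inf_adherent n0 hi.
by exists w => //; exact: ltW.
Qed.

Let p n := s2val (near_min n).
Let q n := g - p n.
Let e (n : nat) : R := n.+1%:R^-1.

Let Wp n : W (p n). Proof. exact: (s2valP (near_min n)). Qed.
Let Tq n : T (q n). Proof. by apply: gW. Qed.
Let qle n : B (q n) (q n) <= dist2 + e n.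
Proof. exact: (s2valP' (near_min n)). Qed.
Let e0 n : 0 < e n. Proof. by rewrite invr_gt0. Qed.
Let e1 n : e n <= 1.
Proof. by rewrite invf_le1 // ler1n. Qed.

(* The midpoint of two nearly closest points is again at distance at least
   [dist2]; the parallelogram law turns this into closeness. *)
Let qmid n k : 4 * dist2 <= B (q n) (q n) + 2 * B (q n) (q k) + B (q k) (q k).
Proof.
have := dist2_le (W_lin 2^-1 (Wp n) (WZ 2^-1 (Wp k))).
have -> : g - (2^-1 *: p n + 2^-1 *: p k) = 2^-1 *: q n + 2^-1 *: q k.
  rewrite !scalerBr addrACA -scalerDl -opprD.
  by rewrite (_ : 2^-1 + 2^-1 = 1) ?scale1r //; lra.
rewrite Bexpand // !expr2; lra.
Qed.

Let cauchyB x : T x -> cvgn (fun n => B x (q n)).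
Proof.
move=> Tx; apply/cauchy_cvgP/cauchy_ballP => eps eps0; near_simpl.
have h0 : 0 < eps ^+ 2 / (B x x * 4 + 1).
  by rewrite divr_gt0 ?exprn_gt0 // ltr_wpDl // mulr_ge0 ?Bge0.
have [N hN] : exists N : nat, forall n, (N <= n)%N -> e n < eps ^+ 2 / (B x x * 4 + 1).
  have /cvgrPdist_lt /(_ _ h0) [N _ hN] := @cvg_harmonic R.
  exists N => n /hN /=; rewrite sub0r normrN ger0_norm //.
near=> n k => /=; rewrite /ball_ /=.
have en : e n < eps ^+ 2 / (B x x * 4 + 1) by apply: hN; near: n; exists N.
have ek : e k < eps ^+ 2 / (B x x * 4 + 1) by apply: hN; near: k; exists N.
have Tnk : T (1 *: q n + - 1 *: q k) by apply: T_lin => //; apply: TZ.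
suff : `|B x (q n) - B x (q k)| < eps by [].
have -> : B x (q n) - B x (q k) = B x (1 *: q n + - 1 *: q k).
  by rewrite BlinR ?mul1r ?[B x (_ *: _)]Bsym ?BZ ?mulN1r 1?[B x (q k)]Bsym //; apply: TZ.
rewrite -[ltRHS]ger0_norm ?ltW // -ltr_sqr ?nnegrE // !real_normK ?num_real //.
apply: le_lt_trans (form_cauchy_schwarz Tx Tnk) _.
have : B (1 *: q n + - 1 *: q k) (1 *: q n + - 1 *: q k) <= 2 * e n + 2 * e k.
  rewrite Bexpand // expr1n sqrrN expr1n.
  have := qmid n k; have := qle n; have := qle k; lra.
move: en ek; rewrite !ltr_pdivlMr ?ltr_wpDl // ?mulr_ge0 ?Bge0 //.
have := Bge0 Tx; have := e0 n; have := e0 k => ek0 en0 bx en ek.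
move=> /(ler_wpM2l bx) /le_lt_trans; apply; nra.
Unshelve. all: by end_near.
Qed.

(** The functional is the limit of [B _ (g - w)] along a sequence of [w] that
    minimizes the distance to [g]: near-minimality makes [g - w] nearly
    orthogonal to [W], so that the limit vanishes there. *)
Lemma separating_functional : exists (L : V -> R) (C : R),
  [/\ forall a x y, T x -> T y -> L (a *: x + y) = a * L x + L y,
      forall w, W w -> L w = 0, 0 < L g &
      forall x, T x -> L x ^+ 2 <= C * B x x].
Proof.
pose L x := limn (fun n => B x (q n)).
have cL x : T x -> (fun n => B x (q n)) @ \oo --> L x by move=> /cauchyB.
have Llin a x y : T x -> T y -> L (a *: x + y) = a * L x + L y.
  move=> Tx Ty; apply/cvg_lim => //.
  under eq_fun do rewrite Blin //.
  by apply: cvgD; [apply: cvgMl_tmp; exact: cL|exact: cL].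
have LW w : W w -> L w = 0.
  move=> Ww; apply/cvg_lim => //.
  have Tw := WT Ww.
  have sqle n : B w (q n) ^+ 2 <= B w w * e n.
    apply: discriminant_le; rewrite ?Bge0 ?ltW // => t.
    have := dist2_le (W_lin (- t) Ww (Wp n)).
    have -> : g - (- t *: w + p n) = t *: w + 1 *: q n.
      by rewrite scale1r /q scaleNr opprD opprK addrCA.
    rewrite Bexpand // mulr1 expr1n mul1r.
    have := qle n; lra.
  have : (fun n => B w (q n) ^+ 2) @ \oo --> 0.
    apply: (@squeeze_cvgr _ _ _ _ (fun=> 0) (fun n => B w w * e n)).
    - by near=> n; rewrite sqr_ge0 sqle.
    - exact: cvg_cst.
    - rewrite -[0](mulr0 (B w w)); apply: cvgMl_tmp; exact: cvg_harmonic.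
  move=> h; have := cvg_comp _ _ h (@sqrt_continuous R 0).
  rewrite sqrtr0 => h2; apply/norm_cvg0P.
  by apply: cvg_trans h2; apply: near_eq_cvg; near=> n => /=; rewrite sqrtr_sqr.
exists L, (dist2 + 1); split => //.
- have [k hk] : exists k, e k < dist2 / 2.
    have d2 : 0 < dist2 / 2 by rewrite divr_gt0.
    have /cvgrPdist_lt /(_ _ d2) [k _ hk] := @cvg_harmonic R.
    exists k; have := hk k (leqnn _); by rewrite sub0r normrN ger0_norm // ltW ?e0.
  have -> : L g = L (q k).
    have -> : q k = -1 *: p k + g by rewrite scaleN1r addrC.
    have Wpk := Wp k; have Tpk := WT Wpk.
    by rewrite Llin // (LW _ Wpk) mulr0 add0r.
  apply: (@lt_le_trans _ _ (dist2 / 4)); first by rewrite divr_gt0.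
  have le1 : \forall n \near \oo, dist2 - e k / 2 - e n / 2 <= B (q k) (q n).
    by near=> n; have := qmid k n; have := qle n; have := qle k; lra.
  have c1 : (fun n => dist2 - e k / 2 - e n / 2) @ \oo --> dist2 - e k / 2 - 0 / 2.
    apply: cvgB; first exact: cvg_cst.
    by apply: cvgMr_tmp; exact: cvg_harmonic.
  have : dist2 - e k / 2 - 0 / 2 <= L (q k).
    exact: (ler_cvg_to c1 (cL _ (Tq k)) le1).
  by move: dist2_gt0; lra.
- move=> x Tx.
  have c1 : (fun n => B x (q n) ^+ 2) @ \oo --> L x ^+ 2.
    by rewrite expr2; under eq_fun do rewrite expr2; apply: cvgM; exact: cL.
  apply: (cvgr_to_le c1); near=> n.
  apply: le_trans (form_cauchy_schwarz Tx (Tq n)) _.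
  rewrite mulrC ler_wpM2r ?Bge0 // (le_trans (qle n)) // lerD2l e1 //.
Unshelve. all: by end_near.
Qed.
End SeparatingFunctional.

(** * Linear combinations of the sequence *)
Section Stationary.
Context d (Om : measurableType d) (R : realType) (P : probability Om R).
Variable X : int -> {RV P >-> R}.
Implicit Types l : seq (R[i] * int).

Definition comb l (w : Om) : R[i] := \sum_(x <- l) x.1 * (X x.2 w)%:C%C.

Definition negT l := [seq (- x.1, x.2) | x <- l].

Lemma comb_cat l l' w : comb (l ++ l') w = comb l w + comb l' w.
Proof. by rewrite /comb big_cat. Qed.

Lemma comb_neg l w : comb (negT l) w = - comb l w.
Proof.
by rewrite /comb big_map -sumrN; apply: eq_bigr => x _; rewrite mulNr.
Qed.

Lemma lin_comb_on (g : int -> R[i]) (r : seq int) w : uniq r ->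
  (forall j, j \notin r -> g j = 0) ->
  lin_comb X g w = comb [seq (g j, j) | j <- r] w.
Proof.
move=> ur g0; rewrite /lin_comb /comb big_map (@fsbigE _ _ _ _ _ r) //.
  by apply: eq_bigl => j; rewrite in_setT.
by move=> j _ /g0 ->; rewrite mul0r.
Qed.

Definition coef l (j : int) : R[i] := \sum_(x <- l | x.2 == j) x.1.

Lemma coef_off l j : (forall x, x \in l -> x.2 != j) -> coef l j = 0.
Proof.
by move=> lj; rewrite /coef big_seq_cond big1 // => x /andP[/lj/negPf ->].
Qed.

Lemma coef_finite l : finitely_supported (coef l).
Proof.
apply: (@sub_finite_set _ _ [set` [seq x.2 | x <- l]]).
  move=> j /=; apply: contraNT => jl; apply/eqP/coef_off => x xl.
  by apply: contraNneq jl => <-; apply: map_f.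
exact: finite_seq.
Qed.

Lemma lin_comb_coef l w : lin_comb X (coef l) w = comb l w.
Proof.
rewrite (@lin_comb_on _ (undup [seq x.2 | x <- l])) ?undup_uniq //; last first.
  move=> j; rewrite mem_undup => jl; apply: coef_off => x xl.
  by apply: contraNneq jl => <-; apply: map_f.
rewrite /comb big_map /=; under eq_bigr do rewrite /coef mulr_suml.
rewrite (exchange_big_dep predT) //= [LHS]big_seq [RHS]big_seq; apply: eq_bigr => x xl.
rewrite big_mkcond (bigD1_seq x.2) ?undup_uniq //=; last by rewrite mem_undup map_f.
by rewrite eqxx big1 ?addr0 // => j; rewrite eq_sym => /negPf ->.
Qed.

Hypothesis X_L2 : square_integrable X.

Lemma X_integrable j : P.-integrable setT (fun w => (X j w)%:E).
Proof.
apply/Lfun1_integrable; apply: (@Lfun_subset12 _ _ _ P) => //.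
exact: fin_num_measure.
Qed.

Lemma XX_integrable i j : P.-integrable setT (fun w => (X i w * X j w)%:E).
Proof. by apply/Lfun1_integrable; apply: Lfun2_mul_Lfun1; exact: X_L2. Qed.

Lemma Rintegral_sum (I : Type) (r : seq I) (F : I -> Om -> R) :
  (forall i, P.-integrable setT (EFin \o F i)) ->
  P.-integrable setT (EFin \o (fun w => \sum_(i <- r) F i w)) /\
  \int[P]_w (\sum_(i <- r) F i w) = \sum_(i <- r) \int[P]_w F i w.
Proof.
move=> iF; elim: r => [|i r [IH1 IH2]].
  under [X in _.-integrable _ X]eq_fun do rewrite /= big_nil.
  under eq_Rintegral do rewrite big_nil.
  rewrite big_nil Rintegral_cst // mul0r; split => //; exact: integrable0.
have e : (fun w => \sum_(i <- i :: r) F i w) =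
    (fun w => F i w + \sum_(i <- r) F i w).
  by apply/funext => w; rewrite big_cons.
rewrite e; split.
  by apply: eq_integrable (integrableD measurableT (iF i) IH1).
by rewrite RintegralD // big_cons IH2.
Qed.

Lemma integrable_scale (F : Om -> R) a : P.-integrable setT (EFin \o F) ->
  P.-integrable setT (EFin \o (fun w => a * F w)).
Proof. by move=> iF; apply: eq_integrable (integrableZl measurableT a iF). Qed.

Hypothesis X_centred : centred X.

Let mean0 j : \int[P]_w X j w = 0.
Proof. by have := X_centred j; rewrite unlock /Rintegral => ->. Qed.

Lemma mean_comb l : cexpectation P (comb l) = 0.
Proof.
rewrite /cexpectation /cRintegral /comb.
have h (a : R[i] -> R) : \int[P]_w (\sum_(x <- l) a x.1 * X x.2 w) = 0.
  have [|_ ->] := @Rintegral_sum _ l (fun x w => a x.1 * X x.2 w).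
    by move=> x; apply: integrable_scale; exact: X_integrable.
  rewrite big1 // => x _; rewrite RintegralZl ?mean0 ?mulr0 //.
  exact: X_integrable.
have -> : (fun w => complex.Re (\sum_(x <- l) x.1 * (X x.2 w)%:C%C)) =
    fun w => \sum_(x <- l) complex.Re x.1 * X x.2 w.
  by apply/funext => w; rewrite Re_sum; apply: eq_bigr => x _; rewrite cReM /= mulr0 subr0.
have -> : (fun w => complex.Im (\sum_(x <- l) x.1 * (X x.2 w)%:C%C)) =
    fun w => \sum_(x <- l) complex.Im x.1 * X x.2 w.
  by apply/funext => w; rewrite Im_sum; apply: eq_bigr => x _; rewrite cImM /= mulr0 add0r.
by rewrite !h.
Qed.

Let nsq_combE l w : nsq (comb l w) = \sum_(x <- l) \sum_(y <- l)
  complex.Re (x.1 * (y.1^*)%C) * (X x.2 w * X y.2 w).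
Proof.
rewrite nsqE /comb conj_sum mulr_suml Re_sum; apply: eq_bigr => x _.
rewrite mulr_sumr Re_sum; apply: eq_bigr => y _.
rewrite conjM; case: x y => [[a b] j] [[a' b'] j'] /=; ring.
Qed.

Lemma integrable_nsq_comb l : P.-integrable setT (EFin \o (fun w => nsq (comb l w))).
Proof.
under eq_fun do rewrite /= nsq_combE.
apply: (Rintegral_sum _ _).1 => x; apply: (Rintegral_sum _ _).1 => y.
exact/integrable_scale/XX_integrable.
Qed.

Lemma cvariance_comb l :
  cvariance P (comb l) = (\int[P]_w nsq (comb l w))%:E.
Proof.
rewrite /cvariance mean_comb unlock.
under eq_integral do rewrite subr0 sqr_normcE.
rewrite fineK //; apply: integrable_fin_num => //; exact: integrable_nsq_comb.
Qed.

Hypothesis X_stationary : wide_sense_stationary X.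

Let covE i j : \int[P]_w (X i w * X j w) = autocov X (j - i).
Proof.
have := X_stationary (j - i) i; rewrite addrC subrK /autocov => <-.
by rewrite unlock.
Qed.

Let autocovN i j : autocov X (i - j) = autocov X (j - i).
Proof. by rewrite -!covE; apply: eq_Rintegral => w _; rewrite mulrC. Qed.

Variable S : {finite_measure set (measurableTypeR R) -> \bar R}.
Hypothesis S_spectral : is_spectral_measure (autocov X) S.

Lemma spectral_fourier j : fourier S (torus R) j = ((2 * pi * autocov X j)%:C)%C.
Proof.
have pi0 := pi_gt0 R; have [_ _ /(_ j)] := S_spectral.
rewrite /fourier; case: (cRintegral _ _ _) => a b.
rewrite /real_complex_def /= => -[ea eb].
have p2 : (2 * pi : R) != 0 by rewrite mulf_neq0 ?pnatr_eq0 // gt_eqF.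
have h2 : (2 * pi : R)^-1 != 0 by rewrite invr_eq0.
have b0 : b = 0.
  by apply: (mulfI h2); rewrite mulr0; move: eb; rewrite mul0r addr0 => <-.
by rewrite ea b0 !mul0r !subr0 mulrA mulfV // mul1r.
Qed.

Lemma S_torus_finite : (S (torus R) < +oo)%E.
Proof. by rewrite ltey_eq fin_num_measure //; exact: measurable_torus. Qed.

(** Both sides are the same quadratic form in the coefficients, with matrix the
    covariances: on the right these appear as Fourier coefficients of [S]. *)
Lemma spectral_isometry l : \int[P]_w nsq (comb l w) =
  (2 * pi)^-1 * \int[S]_(u in torus R) nsq (trig l u).
Proof.
rewrite Rintegral_nsq_trig; [|exact: measurable_torus|exact: S_torus_finite].
under eq_Rintegral do rewrite nsq_combE.
have h x : P.-integrable setT (EFin \o (fun w => \sum_(y <- l)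
    complex.Re (x.1 * (y.1^*)%C) * (X x.2 w * X y.2 w))).
  apply: (Rintegral_sum _ _).1 => y; exact/integrable_scale/XX_integrable.
have [_ ->] := Rintegral_sum l h.
rewrite Re_sum mulr_sumr; apply: eq_bigr => x _.
have [|_ ->] := @Rintegral_sum _ l (fun y w =>
    complex.Re (x.1 * (y.1^*)%C) * (X x.2 w * X y.2 w)).
  by move=> y; exact/integrable_scale/XX_integrable.
rewrite Re_sum mulr_sumr; apply: eq_bigr => y _.
rewrite RintegralZl //; last exact: XX_integrable.
rewrite covE -autocovN spectral_fourier [in RHS]cReM /= mulr0 subr0.
rewrite mulrCA; congr (_ * _); rewrite mulrA mulVf ?mul1r //.
by rewrite mulf_neq0 ?pnatr_eq0 // gt_eqF // pi_gt0.
Qed.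

End Stationary.

(** * From a polynomial to non-rigidity *)
Section WindowPolynomial.
Variable R : realType.

Definition window_seq (m : nat) : seq int :=
  [seq k%:Z - m%:Z | k <- iota 0 (2 * m).+1].

Lemma window_seq_uniq m : uniq (window_seq m).
Proof.
rewrite map_inj_uniq ?iota_uniq // => i j /eqP.
by rewrite (inj_eq (addIr _)) => /eqP [].
Qed.

Lemma mem_window_seq m j : j \in window_seq m <-> int_window m j.
Proof.
split=> [/mapP[k] | /= /andP[j1 j2]].
  rewrite mem_iota /= => kb ->; rewrite /int_window /=; lia.
apply/mapP; exists (absz (j + m%:Z)); last by lia.
rewrite mem_iota; lia.
Qed.

(** The shift by [m] centres the frequencies [0, 2m] of a polynomial in
    [expi u]; it does not change the modulus. *)
Definition poly_trig (m : nat) (p : {poly R[i]}) : seq (R[i] * int) :=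
  [seq (p`_k, k%:Z - m%:Z) | k <- iota 0 (2 * m).+1].

Lemma trig_poly m (p : {poly R[i]}) u : (size p <= (2 * m).+1)%N ->
  trig (poly_trig m p) u = expi (- (m%:R * u)) * p.[expi u].
Proof.
move=> sp; rewrite (horner_coef_wide _ sp) mulr_sumr /trig big_map.
rewrite -[iota _ _]/(index_iota 0 (2 * m).+1) big_mkord.
apply: eq_bigr => k _ /=.
rewrite -expiMn rmorphB mulrBl addrC expiD /=.
by rewrite [LHS]mulrCA; congr (_ * _).
Qed.

Lemma nsq_trig_poly m (p : {poly R[i]}) u : (size p <= (2 * m).+1)%N ->
  nsq (trig (poly_trig m p) u) = nsq p.[expi u].
Proof. by move=> sp; rewrite trig_poly // nsqM nsq_expi mul1r. Qed.

Lemma lebesgue_trig_orthogonality (l l' : seq (R[i] * int)) :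
  cRintegral lebesgue_measure (torus R)
    (fun u => trig l u * ((trig l' u)^*)%C) =
  ((2 * pi)%:C)%C *
    \sum_(x <- l) \sum_(y <- l' | x.2 == y.2) x.1 * (y.1^*)%C.
Proof.
have lT : (lebesgue_measure (torus R) < +oo)%E by rewrite lebesgue_torus ltry.
rewrite cRintegral_trigJ; [|exact: measurable_torus|exact: lT].
rewrite mulr_sumr; apply: eq_bigr => x _; rewrite mulr_sumr [RHS]big_mkcond.
apply: eq_bigr => y _; rewrite lebesgue_fourier subr_eq0.
by case: ifP => _; rewrite ?mulr0 // mulrC.
Qed.

End WindowPolynomial.

Section Rigidity.
Context d (Om : measurableType d) (R : realType) (P : probability Om R).
Variable X : int -> {RV P >-> R}.

Lemma cvariance_ge0 (Z : Om -> R[i]) : (0 <= cvariance P Z)%E.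
Proof. by apply: expectation_ge0 => w; rewrite sqr_normcE nsq_ge0. Qed.

Lemma nonrigidP (g : int -> R[i]) (A : set int) :
  ~ linearly_rigid X g A <-> exists2 e : R, 0 < e &
    forall h, finitely_supported h -> (forall j, A j -> h j = 0) ->
      (e%:E <= cvariance P (fun w => lin_comb X g w - lin_comb X h w)%R)%E.
Proof.
rewrite /linearly_rigid; set V := [set _ | h in _].
have V0 : (0 <= ereal_inf V)%E.
  by apply: le_ereal_inf_tmp => _ [h _ <-]; exact: cvariance_ge0.
split=> [nr|[e e0 he] r0]; last first.
  have : (ereal_inf V < e%:E)%E by rewrite r0 lte_fin.
  move=> /ereal_inf_lt[_ [h [fh hA] <-]]; apply/negP; rewrite -leNgt.
  exact: he.
have Vp : (0 < ereal_inf V)%E by rewrite lt_neqAle V0 andbT eq_sym; apply/eqP.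
have [e e0 eV] : exists2 e : R, 0 < e & (e%:E <= ereal_inf V)%E.
  case: (ereal_inf V) Vp => [r|//|//]; first by rewrite lte_fin; exists r.
  by exists 1 => //; rewrite leey.
exists e => // h fh hA; apply: (le_trans eV); apply: ereal_inf_lbound.
by exists h.
Qed.

Hypotheses (X_L2 : square_integrable X) (X_centred : centred X)
  (X_stationary : wide_sense_stationary X).
Variables (S : {finite_measure set (measurableTypeR R) -> \bar R})
  (s : measurableTypeR R -> R) (m : nat).
Hypotheses (S_spectral : is_spectral_measure (autocov X) S)
  (s_density : is_ac_density S s).

Let mT := @measurable_torus R.

Lemma measurable_nsq_trig (l : seq (R[i] * int)) :
  measurable_fun setT (fun u : measurableTypeR R => nsq (trig l u)).
Proof.
apply: measurable_funD; apply: measurable_funX;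
  [exact: measurable_trigRe|exact: measurable_trigIm].
Qed.

(** Cauchy-Schwarz for the pairing of [q] and [p] over the torus, with the weight
    split as [s * s^-1]: a prescribed pairing with [p] keeps [q] away from 0 in
    [L2(S)]. It takes the form of a pointwise arithmetic-geometric mean
    inequality, whose two terms are then integrated separately. *)
Lemma weighted_lower_bound (p : {poly R[i]}) (c : R) : 0 < c ->
  (size p <= (2 * m).+1)%N ->
  (\int[lebesgue_measure]_(u in torus R)
     ((nsq p.[expi u])%:E * inv_density s u) < +oo)%E ->
  exists2 e : R, 0 < e & forall q, 
    complex.Re (cRintegral lebesgue_measure (torus R)
      (fun u => trig q u * ((trig (poly_trig m p) u)^*)%C)) = c ->
    e <= \int[S]_(u in torus R) nsq (trig q u).
Proof.
move=> c0 sp Kfin; have [ms s0 _ _] := s_density.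
have [N _ [_ decS]] := torus_decomposition s_density.
set J := fun u => ((nsq p.[expi u])%:E * inv_density s u)%E in Kfin.
have i0 u : (0 <= inv_density s u)%E by apply: (inv_density_ge0 s_density).
have J0 u : (0 <= J u)%E by rewrite mule_ge0 // lee_fin nsq_ge0.
have mp : measurable_fun setT (fun u : measurableTypeR R => nsq p.[expi u]).
  have -> : (fun u : R => nsq p.[expi u]) = fun u => nsq (trig (poly_trig m p) u).
    by apply/funext => u; rewrite nsq_trig_poly.
  exact: measurable_nsq_trig.
have mJ : measurable_fun setT J.
  apply: emeasurable_funM; first exact/measurable_EFinP.
  exact: (measurable_inv_density s_density).
have IJ0 : (0 <= \int[lebesgue_measure]_(u in torus R) J u)%E.
  by apply: integral_ge0.
pose K := fine (\int[lebesgue_measure]_(u in torus R) J u).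
have KE : (\int[lebesgue_measure]_(u in torus R) J u = K%:E)%E.
  by rewrite fineK // ge0_fin_numE.
have K0 : 0 <= K by rewrite fine_ge0.
exists (c ^+ 2 / (K + 1)); first by rewrite divr_gt0 ?exprn_gt0 //; lra.
move=> q qc.
(* This [t] balances the two terms of the bound [fle] below. *)
have [t t0 tE] : exists2 t, 0 < t & t = (K + 1) / c.
  by exists ((K + 1) / c) => //; rewrite divr_gt0 //; lra.
set V := \int[S]_(u in torus R) nsq (trig q u).
pose f u := complex.Re (trig q u * ((trig (poly_trig m p) u)^*)%C).
have fE : f = fun u => complex.Re (trig (mulT q (conjT (poly_trig m p))) u).
  by apply/funext => u; rewrite /f trig_mul trig_conj.
have lT : (lebesgue_measure (torus R) < +oo)%E by rewrite lebesgue_torus ltry.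
have mf : measurable_fun (setT : set (measurableTypeR R)) f.
  by rewrite fE; exact: measurable_trigRe.
have fi : lebesgue_measure.-integrable (torus R) (EFin \o f).
  by rewrite fE; exact: integrable_trigRe.
have fc : (c%:E = \int[lebesgue_measure]_(u in torus R) (f u)%:E)%E.
  have <- : \int[lebesgue_measure]_(u in torus R) f u = c by exact: qc.
  by rewrite fineK //; apply: integrable_fin_num.
have t2 : 0 <= t / 2 by rewrite divr_ge0 // ltW.
have t2p : 0 < (2 * t)^-1 by rewrite invr_gt0 pmulr_rgt0.
have t2' := ltW t2p.
have qs0 u : (0 <= (nsq (trig q u) * s u)%:E)%E.
  by rewrite lee_fin mulr_ge0 ?nsq_ge0.
have fle u : (`|(f u)%:E| <= (t / 2)%:E * (nsq (trig q u) * s u)%:E +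
    ((2 * t)^-1)%:E * J u)%E.
  have f2 : f u ^+ 2 <= nsq (trig q u) * nsq p.[expi u].
    rewrite -(@nsq_trig_poly _ m) // /f.
    case: (trig q u) (trig (poly_trig m p) u) => a b [a' b']; rewrite /nsq /=.
    have -> : (a ^+ 2 + b ^+ 2) * (a' ^+ 2 + b' ^+ 2) =
      (a * a' - b * - b') ^+ 2 + (a * b' - b * a') ^+ 2 by ring.
    by rewrite lerDl sqr_ge0.
  have [su|sn] := eqVneq (s u) 0.
    have [p_0|pn] := eqVneq (nsq p.[expi u]) 0.
      have -> : f u = 0 by apply/eqP; rewrite -sqrf_eq0 eq_le sqr_ge0 andbT (le_trans f2) // p_0 mulr0.
      by rewrite abse0; apply: adde_ge0; apply: mule_ge0.
    rewrite /J /inv_density su /inve eqxx gt0_muley ?lte_fin ?lt0r ?pn ?nsq_ge0 //.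
    by rewrite gt0_muley ?lte_fin // addey ?leey // -EFinM.
  have sp0 : 0 < s u by rewrite lt0r sn s0.
  rewrite /J /inv_density /inve (negPf sn) -!EFinM -EFinD lee_fin.
  set x := nsq (trig q u) in f2 *; set y := nsq p.[expi u] in f2 *.
  have x0 : 0 <= x by exact: nsq_ge0. have y0 : 0 <= y by exact: nsq_ge0.
  set a := t / 2 * (x * s u); set b := (2 * t)^-1 * (y / s u).
  have a0 : 0 <= a by rewrite !mulr_ge0 // ltW.
  have b0 : 0 <= b by rewrite !mulr_ge0 // invr_ge0 ?mulr_ge0 // ltW.
  have ab : 4 * (a * b) = x * y by rewrite /a /b; field; rewrite sn gt_eqF.
  rewrite -ler_sqr ?nnegrE ?addr_ge0 // real_normK ?num_real //.
  apply: (le_trans f2); rewrite -ab.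
  have : 0 <= (a - b) ^+ 2 by rewrite sqr_ge0.
  nra.
have Vint : (\int[S]_(u in torus R) (nsq (trig q u))%:E = V%:E)%E.
  rewrite fineK //; apply: integrable_fin_num => //.
  have -> : (fun u => (nsq (trig q u))%:E) = (fun u => (complex.Re (trig (mulT q (conjT q)) u))%:E).
    by apply/funext => u; rewrite trig_mul trig_conj nsqE.
  by apply: integrable_trigRe => //; exact: (S_torus_finite S).
have le1 : (\int[lebesgue_measure]_(u in torus R) (nsq (trig q u) * s u)%:E <= V%:E)%E.
  rewrite -Vint; have [||//] := decS (fun u => nsq (trig q u)).
    exact: measurable_nsq_trig.
  by move=> u; exact: nsq_ge0.
have mqs : measurable_fun (torus R) (fun u => (nsq (trig q u) * s u)%:E).
  apply: measurable_funTS; apply/measurable_EFinP; apply: measurable_funM => //.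
  exact: measurable_nsq_trig.
have : (c%:E <= (t / 2)%:E * V%:E + ((2 * t)^-1)%:E * K%:E)%E.
  rewrite fc; apply: le_trans (lee_abs _) _.
  apply: le_trans (le_abse_integral _ _ _) _ => //.
    by apply: measurable_funTS; exact/measurable_EFinP.
  apply: (@le_trans _ _ (\int[lebesgue_measure]_(u in torus R)
     ((t / 2)%:E * (nsq (trig q u) * s u)%:E + ((2 * t)^-1)%:E * J u))%E).
    apply: ge0_le_integral => //.
    - by apply: measurableT_comp => //; apply: measurable_funTS; exact/measurable_EFinP.
    - by apply: emeasurable_funD; apply: measurable_funeM => //; exact: measurable_funTS.
  rewrite ge0_integralD //; last 4 first.
  - by move=> u _; rewrite mule_ge0.
  - by apply: measurable_funeM.
  - by move=> u _; rewrite mule_ge0.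
  - by apply: measurable_funeM; exact: measurable_funTS.
  rewrite !ge0_integralZl_EFin //; last exact: measurable_funTS.
  by rewrite KE leeD2r // lee_wpmul2l // lee_fin.
rewrite -!EFinM -EFinD lee_fin => h.
have -> : c ^+ 2 / (K + 1) = c / t by rewrite tE; field; rewrite !gt_eqF //; lra.
rewrite ler_pdivrMr //.
have h2 : (2 * t)^-1 * K <= c / 2.
  have -> : (2 * t)^-1 * K = c / 2 * (K / (K + 1)).
    by rewrite tE; field; rewrite !gt_eqF //; lra.
  apply: ler_piMr; first by lra.
  by rewrite ler_pdivrMr ?mul1r; lra.
lra.
Qed.

End Rigidity.
Section Nonrigid.
Context d (Om : measurableType d) (R : realType) (P : probability Om R).
Variable X : int -> {RV P >-> R}.

Lemma coef_poly_trig m (p : {poly R[i]}) k : (k <= 2 * m)%N ->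
  coef (poly_trig m p) (k%:Z - m%:Z) = p`_k.
Proof.
move=> km; rewrite /coef big_map.
rewrite big_mkcond (bigD1_seq k) ?iota_uniq ?mem_iota //=.
rewrite eqxx big1 ?addr0 // => i ik.
by rewrite (inj_eq (addIr _)) eqz_nat (negPf ik).
Qed.

Lemma coef_poly_trig_off m (p : {poly R[i]}) j : ~ int_window m j ->
  coef (poly_trig m p) j = 0.
Proof.
move=> jm; apply: coef_off => x /mapP[k km ->] /=.
by apply: contra_notN jm => /eqP <-; apply/mem_window_seq/mapP; exists k.
Qed.

Lemma torus_pairing (l l' : seq (R[i] * int)) :
  cRintegral lebesgue_measure (torus R)
    (fun u => trig l u * ((trig l' u)^*)%C) =
  ((2 * pi)%:C)%C * \sum_(x <- l) x.1 * ((coef l' x.2)^*)%C.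
Proof.
rewrite lebesgue_trig_orthogonality; congr (_ * _); apply: eq_bigr => x _.
rewrite /coef conj_sum mulr_sumr; apply: eq_bigl => y.
by rewrite eq_sym.
Qed.

Hypotheses (X_L2 : square_integrable X) (X_centred : centred X)
  (X_stationary : wide_sense_stationary X).
Variables (S : {finite_measure set (measurableTypeR R) -> \bar R})
  (s : measurableTypeR R -> R) (m : nat).
Hypotheses (S_spectral : is_spectral_measure (autocov X) S)
  (s_density : is_ac_density S s).

Let fs_seq (h : int -> R[i]) : finitely_supported h ->
  exists2 r : seq int, uniq r & forall j, (j \in r) = (h j != 0).
Proof.
move=> fh; exists (finmap.enum_fset (fset_set [set j | h j != 0])).
  exact: finmap.fset_uniq.
by move=> j; rewrite in_fset_set //; apply/idP/idP; rewrite inE.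
Qed.

Let window_comb (g : int -> R[i]) : (forall j, ~ int_window m j -> g j = 0) ->
  forall w, lin_comb X g w = comb X [seq (g j, j) | j <- window_seq m] w.
Proof.
move=> g0 w; apply: lin_comb_on; first exact: window_seq_uniq.
by move=> j jm; apply: g0; apply: contraNnot jm => /mem_window_seq.
Qed.

(** Combinations with indices off the window are orthogonal to [p du], so that
    subtracting them from [g] does not change its pairing with [p]. *)
Lemma nonrigid_of_poly (p : {poly R[i]}) (g : int -> R[i]) :
  (forall j, ~ int_window m j -> g j = 0) ->
  (size p <= (2 * m).+1)%N ->
  (\int[lebesgue_measure]_(u in torus R)
     ((nsq p.[expi u])%:E * inv_density s u) < +oo)%E ->
  0 < complex.Re (\sum_(k < (2 * m).+1) g (k%:Z - m%:Z) * ((p`_k)^*)%C) ->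
  ~ linearly_rigid X g (int_window m).
Proof.
move=> g0 sp pfin gp; apply/nonrigidP.
have pi2 : 0 < 2 * pi :> R by rewrite mulr_gt0 // pi_gt0.
have c0 := mulr_gt0 pi2 gp.
have [e e0 he] := weighted_lower_bound s_density c0 sp pfin.
exists ((2 * pi)^-1 * e) => [|h fh h0]; first by rewrite mulr_gt0 // invr_gt0.
have [r ur rh] := fs_seq fh.
set lg := [seq (g j, j) | j <- window_seq m].
set lh := [seq (h j, j) | j <- r].
have -> : (fun w => lin_comb X g w - lin_comb X h w) = comb X (lg ++ negT lh).
  apply/funext => w; rewrite comb_cat comb_neg window_comb //.
  rewrite (@lin_comb_on _ _ _ _ X h r) // => j; rewrite rh negbK; exact: eqP.
rewrite cvariance_comb // (spectral_isometry X_L2 X_stationary S_spectral).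
rewrite lee_fin ler_wpM2l ?invr_ge0 ?(ltW pi2) //; apply: he.
have [L LE] : exists L, L = lg by exists lg.
rewrite -LE torus_pairing cReM /= mul0r subr0; congr (_ * complex.Re _).
rewrite big_cat /= [X in _ + X]big1_seq ?addr0; last first.
  move=> _ /andP[_ /mapP[_ /mapP[j jr ->] ->]] /=.
  rewrite coef_poly_trig_off /= ?oppr0 ?mulr0 // => jm.
  by move: jr; rewrite rh h0 ?eqxx.
rewrite LE !big_map -[iota _ _]/(index_iota 0 (2 * m).+1) big_mkord.
by apply: eq_bigr => k _; rewrite coef_poly_trig // -ltnS.
Qed.

(** * From non-rigidity to a polynomial *)

Definition rcomb (l : seq (R * int)) (w : Om) : R := \sum_(x <- l) x.1 * X x.2 w.

Definition reT (l : seq (R[i] * int)) := [seq (complex.Re x.1, x.2) | x <- l].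
Definition imT (l : seq (R[i] * int)) := [seq (complex.Im x.1, x.2) | x <- l].

Lemma Re_comb l w : complex.Re (comb X l w) = rcomb (reT l) w.
Proof.
rewrite /comb Re_sum /rcomb big_map; apply: eq_bigr => x _.
by rewrite cReM /= mulr0 subr0.
Qed.

Lemma Im_comb l w : complex.Im (comb X l w) = rcomb (imT l) w.
Proof.
rewrite /comb Im_sum /rcomb big_map; apply: eq_bigr => x _.
by rewrite cImM /= mulr0 add0r.
Qed.

Definition off_window (l : seq (R * int)) := forall x, x \in l -> ~ int_window m x.2.

Definition real_nonrigid (b : int -> R) := exists2 e : R, 0 < e &
  forall l, off_window l -> e <= \int[P]_w
   (rcomb [seq (b j, j) | j <- window_seq m] w - rcomb l w) ^+ 2.

Lemma Lfun2_rcomb l : rcomb l \in Lfun P 2%:E.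
Proof.
have [h0 h] := @Lfun_submod_closed _ _ _ P 2%:E (lee1n 2).
rewrite /rcomb; elim: l => [|x l IH].
  by under eq_fun do rewrite big_nil.
under eq_fun do rewrite big_cons.
exact: (h x.1 _ _ (X_L2 x.2) IH).
Qed.

Lemma integrable_mul (f g : Om -> R) : f \in Lfun P 2%:E -> g \in Lfun P 2%:E ->
  P.-integrable setT (EFin \o (fun w => f w * g w)).
Proof. by move=> f2 g2; apply/Lfun1_integrable; exact: Lfun2_mul_Lfun1. Qed.

Lemma Lfun2_lin a (f g : Om -> R) : f \in Lfun P 2%:E -> g \in Lfun P 2%:E ->
  (fun w => a * f w + g w) \in Lfun P 2%:E.
Proof.
have [_ h] := @Lfun_submod_closed _ _ _ P 2%:E (lee1n 2).
by move=> f2 g2; exact: (h a _ _ f2 g2).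
Qed.

(** A complex combination is close to [g] when its real and imaginary parts
    are, so one of the two parts of [g] must already be far from the span. *)
Lemma nonrigid_real (g : int -> R[i]) :
  (forall j, ~ int_window m j -> g j = 0) ->
  ~ linearly_rigid X g (int_window m) ->
  real_nonrigid (fun j => complex.Re (g j)) \/
  real_nonrigid (fun j => complex.Im (g j)).
Proof.
move=> g0 /nonrigidP[e e0 he]; apply: contrapT => /not_orP[n1 n2].
have e2 : 0 < e / 2 by rewrite divr_gt0.
have close b : ~ real_nonrigid b -> exists2 l, off_window l &
    \int[P]_w (rcomb [seq (b j, j) | j <- window_seq m] w - rcomb l w) ^+ 2 < e / 2.
  move=> nb; apply: contrapT => nl; apply: nb; exists (e / 2) => // l ol.
  by rewrite leNgt; apply/negP => lt; apply: nl; exists l.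
have [l1 o1 c1] := close _ n1; have [l2 o2 c2] := close _ n2.
pose lc := [seq ((x.1 +i* 0)%C, x.2) | x <- l1] ++
           [seq ((0 +i* x.1)%C, x.2) | x <- l2].
have := he (coef lc) (coef_finite lc).
have olc j : int_window m j -> coef lc j = 0.
  move=> jm; apply: coef_off => x; rewrite mem_cat => /orP[] /mapP[y yl ->] /=.
    by apply/eqP => yj; apply: (o1 _ yl); rewrite yj.
  by apply/eqP => yj; apply: (o2 _ yl); rewrite yj.
move=> /(_ olc); set lg := [seq (g j, j) | j <- window_seq m].
have -> : (fun w => lin_comb X g w - lin_comb X (coef lc) w) =
    comb X (lg ++ negT lc).
  by apply/funext => w; rewrite comb_cat comb_neg window_comb // lin_comb_coef.
rewrite cvariance_comb // lee_fin leNgt => /negP; apply.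
set f1 := fun w => (rcomb [seq (complex.Re (g j), j) | j <- window_seq m] w - rcomb l1 w) in c1.
set f2 := fun w => (rcomb [seq (complex.Im (g j), j) | j <- window_seq m] w - rcomb l2 w) in c2.
have L1 : f1 \in Lfun P 2%:E.
  have := Lfun2_lin (-1) (Lfun2_rcomb l1) (Lfun2_rcomb [seq (complex.Re (g j), j) | j <- window_seq m]).
  rewrite (_ : (fun w => -1 * rcomb l1 w + _) = f1) //.
  by apply/funext => w; rewrite /f1 mulN1r addrC.
have L2 : f2 \in Lfun P 2%:E.
  have := Lfun2_lin (-1) (Lfun2_rcomb l2) (Lfun2_rcomb [seq (complex.Im (g j), j) | j <- window_seq m]).
  rewrite (_ : (fun w => -1 * rcomb l2 w + _) = f2) //.
  by apply/funext => w; rewrite /f2 mulN1r addrC.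
have -> : (fun w => nsq (comb X (lg ++ negT lc) w)) = fun w => f1 w ^+ 2 + f2 w ^+ 2.
  apply/funext => w; rewrite comb_cat comb_neg /nsq cReB cImB !Re_comb !Im_comb.
  rewrite /f1 /f2 /reT /imT -!map_comp /rcomb /lc !map_cat !big_cat !big_map /=.
  have z l : \sum_(x <- l) 0 * X x.2 w = 0 by rewrite big1 // => x _; rewrite mul0r.
  by rewrite !z addr0 add0r.
have c1' : \int[P]_w f1 w ^+ 2 < e / 2 := c1.
have c2' : \int[P]_w f2 w ^+ 2 < e / 2 := c2.
rewrite RintegralD //; [lra| |].
- by move: (integrable_mul L1 L1).
- by move: (integrable_mul L2 L2).
Qed.

End Nonrigid.
Section Coefficients.
Context d (Om : measurableType d) (R : realType) (P : probability Om R).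
Variable X : int -> {RV P >-> R}.
Hypotheses (X_L2 : square_integrable X) (X_centred : centred X)
  (X_stationary : wide_sense_stationary X).
Variable m : nat.

(** The separating functional acts on all square integrable variables; on
    combinations of the sequence it is given by its values on the [X j], which
    vanish off the window. Splitting into real and imaginary parts extends the
    bound to complex combinations. *)
Lemma separating_coefficients (b : int -> R) : real_nonrigid X m b ->
  exists (a : int -> R) (C : R),
  [/\ forall j, ~ int_window m j -> a j = 0,
      0 < \sum_(j <- window_seq m) b j * a j &
      forall l : seq (R[i] * int),
        nsq (\sum_(x <- l) x.1 * (a x.2)%:C%C) <=
        C * \int[P]_w nsq (comb X l w)].
Proof.
move=> [e e0 he].
pose V : lmodType R := (Om -> R^o)%type.
pose B (f g : V) : R := \int[P]_w (f w * g w).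
pose T : set V := [set f | (f : Om -> R) \in Lfun P 2%:E].
pose W : set V := [set f | exists2 l, off_window m l & f = rcomb X l].
pose g : V := rcomb X [seq (b j, j) | j <- window_seq m].
have iB (f h : V) : T f -> T h -> P.-integrable setT (EFin \o (fun w => f w * h w)).
  exact: integrable_mul.
have T_lin a (x y : V) : T x -> T y -> T (a *: x + y) by exact: Lfun2_lin.
have WT : W `<=` T by move=> _ [l _ ->]; exact: Lfun2_rcomb.
have [L [C [Llin LW Lg LC]]] : exists (L : V -> R) (C : R),
  [/\ forall a x y, T x -> T y -> L (a *: x + y) = a * L x + L y,
      forall w, W w -> L w = 0, 0 < L g &
      forall x, T x -> L x ^+ 2 <= C * B x x].
  apply: (@separating_functional R V B T W) e0 _ => //.
  - move=> a _ _ [l ol ->] [l' ol' ->].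
    exists ([seq (a * x.1, x.2) | x <- l] ++ l').
      move=> x; rewrite mem_cat => /orP[/mapP[y yl ->]|xl]; last exact: ol' xl.
      exact: ol yl.
    apply/funext => w; rewrite /rcomb big_cat big_map; congr (_ + _).
    transitivity (a * \sum_(x <- l) x.1 * X x.2 w) => //.
    by rewrite mulr_sumr; apply: eq_bigr => x _; rewrite mulrA.
  - exists [::]; first by move=> x.
    by apply/funext => w; rewrite /rcomb big_nil.
  - by move=> x y _ _; apply: eq_Rintegral => w _; rewrite mulrC.
  - move=> a x y z Tx Ty Tz; rewrite /B.
    have -> : (fun w => (a *: x + y) w * z w) = fun w => a * (x w * z w) + y w * z w.
      by apply/funext => w; rewrite mulrDl -mulrA.
    have ixz := iB _ _ Tx Tz.
    rewrite RintegralD //; [|exact: integrable_scale|exact: iB].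
    by rewrite RintegralZl.
  - by move=> x Tx; apply: Rintegral_ge0 => w _; rewrite -expr2 sqr_ge0.
  - exact: Lfun2_rcomb.
  - by move=> _ [l ol ->]; exact: he.
have Lcomb l : L (rcomb X l) = \sum_(x <- l) x.1 * L (X x.2).
  elim: l => [|x l IH].
    rewrite big_nil; apply: LW; by exists [::] => // x.
  rewrite big_cons -IH -Llin; [|exact: X_L2|exact: Lfun2_rcomb].
  by congr L; apply/funext => w; rewrite /rcomb big_cons.
exists (fun j => L (X j)), C; split.
- move=> j jm; apply: LW; exists [:: (1, j)].
    by move=> x; rewrite mem_seq1 => /eqP ->.
  by apply/funext => w; rewrite /rcomb big_seq1 mul1r.
- by move: Lg; rewrite Lcomb big_map.
- move=> l; set z := \sum_(x <- l) _.
  have zr : complex.Re z = L (rcomb X (reT l)).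
    rewrite Lcomb big_map Re_sum; apply: eq_bigr => x _.
    by rewrite cReM /= mulr0 subr0.
  have zi : complex.Im z = L (rcomb X (imT l)).
    rewrite Lcomb big_map Im_sum; apply: eq_bigr => x _.
    by rewrite cImM /= mulr0 add0r.
  have -> : (fun w => nsq (comb X l w)) = fun w =>
      rcomb X (reT l) w * rcomb X (reT l) w + rcomb X (imT l) w * rcomb X (imT l) w.
    by apply/funext => w; rewrite /nsq Re_comb Im_comb !expr2.
  have Lr := @Lfun2_rcomb _ _ _ _ _ X_L2 (reT l).
  have Li := @Lfun2_rcomb _ _ _ _ _ X_L2 (imT l).
  rewrite RintegralD //; [|exact: integrable_mul|exact: integrable_mul].
  rewrite /nsq zr zi mulrDr lerD //; exact: LC.
Qed.

Hypotheses (S : {finite_measure set (measurableTypeR R) -> \bar R})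
  (S_spectral : is_spectral_measure (autocov X) S).

Definition window_trig (a : int -> R) : seq (R[i] * int) :=
  [seq ((a j)%:C%C, j) | j <- window_seq m].

(** By orthogonality of the exponentials, the integral against the conjugate of
    [u |-> \sum_k a k * expi (k * u)] is, up to [2 * pi], the functional with
    coefficients [a]; the isometry turns its bound into one in [L2(S)]. *)
Lemma trig_pairing_bound (a : int -> R) (C : R) :
  (forall j, ~ int_window m j -> a j = 0) ->
  (forall l : seq (R[i] * int), nsq (\sum_(x <- l) x.1 * (a x.2)%:C%C) <=
        C * \int[P]_w nsq (comb X l w)) ->
  forall F, trigreal F ->
  (\int[lebesgue_measure]_(u in torus R) (F u * complex.Re (trig (window_trig a) u))) ^+ 2 <=
    2 * pi * C * \int[S]_(u in torus R) (F u) ^+ 2 /\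
  (\int[lebesgue_measure]_(u in torus R) (F u * complex.Im (trig (window_trig a) u))) ^+ 2 <=
    2 * pi * C * \int[S]_(u in torus R) (F u) ^+ 2.
Proof.
move=> a0 aC F [l0 FE].
(* The real part of a trigonometric polynomial is again one, now with complex
   coefficients and real values. *)
pose l := mulT [:: (((2^-1)%:C)%C, 0)] (l0 ++ conjT l0).
have lE u : trig l u = ((F u)%:C)%C.
  rewrite trig_mul {1}/trig big_seq1 mul0r expi0 mulr1 trig_cat trig_conj FE.
  case: (trig l0 u) => x y; apply/eqP; rewrite eq_complex /=.
  by apply/andP; split; apply/eqP; field.
have pi2 : 0 < 2 * pi :> R by rewrite mulr_gt0 // pi_gt0.
set la := window_trig a.
have la_coef j : coef la j = ((a j)%:C)%C.
  have [jm|jm] := pselect (int_window m j); last first.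
    rewrite a0 //; apply: coef_off => x /mapP[k /mem_window_seq km ->] /=.
    by apply/eqP => kj; apply: jm; rewrite -kj.
  rewrite /coef big_map big_mkcond (bigD1_seq j) ?window_seq_uniq //=; last exact/mem_window_seq.
  by rewrite eqxx big1 ?addr0 // => k /negPf ->.
have := torus_pairing l la; set z := cRintegral _ _ _ => zE.
have zr : complex.Re z = \int[lebesgue_measure]_(u in torus R) (F u * complex.Re (trig (window_trig a) u)).
  apply: eq_Rintegral => u _; rewrite lE cReM cReJ cImJ /=; ring.
have zi : complex.Im z = - \int[lebesgue_measure]_(u in torus R) (F u * complex.Im (trig (window_trig a) u)).
  rewrite -mulN1r -RintegralZl //.
  - apply: eq_Rintegral => u _; rewrite lE cImM cReJ cImJ /=; ring.
  - exact: measurable_torus.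
  - have lT : (lebesgue_measure (torus R) < +oo)%E by rewrite lebesgue_torus ltry.
    have := integrable_trigIm (@measurable_torus R) lT (mulT l la).
    congr (_.-integrable _ _); apply/funext => u /=.
    by rewrite trig_mul lE cImM /= mul0r addr0.
have nz : nsq z <= 2 * pi * C * \int[S]_(u in torus R) (F u) ^+ 2.
  rewrite zE nsqM.
  have -> : \sum_(x <- l) x.1 * ((coef la x.2)^*)%C = \sum_(x <- l) x.1 * ((a x.2)%:C)%C.
    by apply: eq_bigr => x _; rewrite la_coef /= oppr0.
  have := aC l; rewrite (spectral_isometry X_L2 X_stationary S_spectral).
  have -> : \int[S]_(u in torus R) nsq (trig l u) = \int[S]_(u in torus R) F u ^+ 2.
    by apply: eq_Rintegral => u _; rewrite lE nsq_real.
  set I := \int[S]_(u in torus R) _ => h.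
  rewrite nsq_real.
  have /(ler_wpM2l (sqr_ge0 (2 * pi))) := h.
  have -> // : (2 * pi) ^+ 2 * (C * ((2 * pi)^-1 * I)) = 2 * pi * C * I.
  have gen (q : R) : q != 0 -> q ^+ 2 * (C * (q^-1 * I)) = q * C * I.
    by move=> q0; field.
  by rewrite gen // gt_eqF.
move: nz; rewrite /nsq zr zi sqrrN.
move=> nz; split; apply: le_trans nz; first by rewrite lerDl sqr_ge0.
by rewrite lerDr sqr_ge0.
Qed.

End Coefficients.
Section BoundedConvergence.
Variables (R : realType) (mu : {measure set (measurableTypeR R) -> \bar R})
  (D : set (measurableTypeR R)).
Hypotheses (mD : measurable D) (muD : (mu D < +oo)%E).

Lemma bounded_convergence (F : nat -> measurableTypeR R -> R)
    (f : measurableTypeR R -> R) (M : R) :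
  (forall n, measurable_fun D (F n)) ->
  (forall n u, D u -> `|F n u| <= M) ->
  (forall u, D u -> F n u @[n --> \oo] --> f u) ->
  \int[mu]_(u in D) F n u @[n --> \oo] --> \int[mu]_(u in D) f u.
Proof.
move=> mF bF cF.
have mf : measurable_fun D f by exact: measurable_fun_cvg mF cF.
have bf u : D u -> `|f u| <= M.
  move=> Du; apply: (cvgr_to_le (cvg_norm (cF _ Du))).
  by near=> n; exact: bF.
have fi : mu.-integrable D (EFin \o f) by exact: bounded_integrable bf.
apply: fine_cvg; rewrite fineK; last exact: integrable_fin_num.
apply: (@dominated_cvg _ _ _ mu D mD (fun n u => (F n u)%:E) (EFin \o f) (fun=> M%:E)).
- by move=> n; exact/measurable_EFinP.
- by move=> u Du; apply: cvg_EFin; [near=> n|exact: cF].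
- by [].
- by apply: (@bounded_integrable _ _ _ mD muD (fun=> M) `|M|).
- by move=> n u Du; rewrite lee_fin bF.
Unshelve. all: by end_near.
Qed.

End BoundedConvergence.

Section WeightedUpperBound.
Variables (R : realType) (S : {finite_measure set (measurableTypeR R) -> \bar R})
  (s : measurableTypeR R -> R) (q : measurableTypeR R -> R) (K M : R).
Hypotheses (s_density : is_ac_density S s) (mq : measurable_fun setT q)
  (bq : forall u, `|q u| <= M).
Hypothesis q_bound : forall F, trigreal F ->
  (\int[lebesgue_measure]_(u in torus R) (F u * q u)) ^+ 2 <=
    K * \int[S]_(u in torus R) (F u) ^+ 2.

Let mT := @measurable_torus R.
Let lT : (lebesgue_measure (torus R) < +oo)%E.
Proof. by rewrite lebesgue_torus ltry. Qed.

(** Both sides of the bound pass to bounded pointwise limits. *)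
Let pclosure_bound (F : R -> R) : pclosure (torus R) (@trigreal R) F ->
  measurable_fun (torus R) F /\
  (\int[lebesgue_measure]_(u in torus R) (F u * q u)) ^+ 2 <=
    K * \int[S]_(u in torus R) (F u) ^+ 2.
Proof.
elim=> [{}F AF|F_ {}F N _ IH bF cF].
  split; last exact: q_bound.
  by case: AF => l ->; apply: measurable_funTS; exact: measurable_trigRe.
have mF n := (IH n).1.
split; first exact: measurable_fun_cvg mF cF.
have mqT : measurable_fun (torus R) q by exact: measurable_funTS.
have c1 : \int[lebesgue_measure]_(u in torus R) (F_ n u * q u) @[n --> \oo] -->
    \int[lebesgue_measure]_(u in torus R) (F u * q u).
  apply: (@bounded_convergence _ _ _ mT lT _ _ (N * M)).
  - by move=> n; exact: measurable_funM.
  - by move=> n u Tu; rewrite normrM ler_pM // bF.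
  - by move=> u Tu; apply: cvgMr_tmp; exact: cF.
have c2 : \int[S]_(u in torus R) (F_ n u) ^+ 2 @[n --> \oo] -->
    \int[S]_(u in torus R) (F u) ^+ 2.
  apply: (@bounded_convergence _ _ _ mT (S_torus_finite S) _ _ (N ^+ 2)).
  - by move=> n; exact: measurable_funX.
  - by move=> n u Tu; rewrite normrX lerXn2r ?nnegrE ?bF // (le_trans _ (bF n u Tu)).
  - by move=> u Tu; rewrite expr2; under eq_fun do rewrite expr2; apply: cvgM; exact: cF.
have c1' : (\int[lebesgue_measure]_(u in torus R) (F_ n u * q u)) ^+ 2 @[n --> \oo] -->
    (\int[lebesgue_measure]_(u in torus R) (F u * q u)) ^+ 2.
  by rewrite expr2; under eq_fun do rewrite expr2; exact: cvgM.
have c2' : K * \int[S]_(u in torus R) (F_ n u) ^+ 2 @[n --> \oo] -->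
    K * \int[S]_(u in torus R) (F u) ^+ 2 by exact: cvgMl_tmp c2.
have le : \forall n \near \oo, (\int[lebesgue_measure]_(u in torus R) (F_ n u * q u)) ^+ 2
    <= K * \int[S]_(u in torus R) (F_ n u) ^+ 2.
  by near=> n; exact: (IH n).2.
exact: ler_cvg_to c1' c2' le.
Unshelve. all: by end_near.
Qed.

Let bounded_bound (F : measurableTypeR R -> R) (N : R) : measurable_fun setT F ->
  (forall u, `|F u| <= N) ->
  (\int[lebesgue_measure]_(u in torus R) (F u * q u)) ^+ 2 <=
    K * \int[S]_(u in torus R) (F u) ^+ 2.
Proof.
by move=> mF bF; exact: (pclosure_bound (bounded_measurable_pclosure mF bF)).2.
Qed.

(** The bound is tested on [q / (s + e)], set to 0 on the null set carrying the
    singular part. With [I] the integral of [q ^ 2 / (s + e)] it reads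
    [I ^ 2 <= K * I], because [s / (s + e) <= 1]; then [e] tends to 0. *)
Lemma weighted_upper_bound : 0 <= K ->
  (\int[lebesgue_measure]_(u in torus R) ((q u ^+ 2)%:E * inv_density s u)
    <= K%:E)%E.
Proof.
move=> K0; have [N mN [N0 dec]] := torus_decomposition s_density.
have [ms s0 _ _] := s_density.
have M0 : 0 <= M by exact: le_trans (bq 0).
pose e n : R := n.+1%:R^-1.
have e0 n : 0 < e n by rewrite invr_gt0.
have se n u : 0 < s u + e n by rewrite ltr_wpDl.
pose F n u : R := \1_(~` N) u * (q u / (s u + e n)).
have msV n : measurable_fun setT (fun u : measurableTypeR R => (s u + e n)^-1).
  have -> : (fun u => (s u + e n)^-1) = fun u => (s u + e n) `^ (-1).
    by apply/funext => u; rewrite powR_inv1 // ltW.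
  by apply: (measurableT_comp (measurable_powR _)); exact: measurable_funD.
have mF n : measurable_fun setT (F n).
  apply: measurable_funM; first by apply: measurable_indic; exact: measurableC.
  exact: measurable_funM.
have bF n u : `|F n u| <= M * n.+1%:R.
  rewrite /F normrM indicE.
  have h : `|q u / (s u + e n)| <= M * n.+1%:R.
    rewrite normrM ler_pM // ger0_norm ?invr_ge0 ?(ltW (se n u)) //.
    rewrite invf_ple ?posrE //; by rewrite lerDr.
  by case: (u \in _); rewrite ?normr1 ?normr0 ?mul1r ?mul0r // mulr_ge0.
pose G n u : R := \1_(~` N) u * (q u ^+ 2 / (s u + e n)).
have mG n : measurable_fun setT (G n).
  apply: measurable_funM; first by apply: measurable_indic; exact: measurableC.
  by apply: measurable_funM => //; exact: measurable_funX.
have G0 n u : 0 <= G n u.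
  by rewrite mulr_ge0 // mulr_ge0 ?sqr_ge0 ?invr_ge0 ?(ltW (se _ _)).
have GE n u : F n u * q u = G n u by rewrite /F /G; ring.
have bG n u : `|G n u| <= M * n.+1%:R * M.
  by rewrite -GE normrM ler_pM.
have iG n : lebesgue_measure.-integrable (torus R) (EFin \o G n).
  apply: (@bounded_integrable _ _ _ mT lT _ _ _ (fun u _ => bG n u)).
  exact: measurable_funTS.
have IG n : (\int[lebesgue_measure]_(u in torus R) (G n u)%:E <= K%:E)%E.
  have := bounded_bound (mF n) (bF n).
  have -> : \int[lebesgue_measure]_(u in torus R) (F n u * q u) =
      \int[lebesgue_measure]_(u in torus R) G n u.
    by apply: eq_Rintegral => u _; exact: GE.
  have [||_ decE] := dec (fun u => F n u ^+ 2).
  - exact: measurable_funX.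
  - by move=> u; exact: sqr_ge0.
  rewrite {2}/Rintegral decE; last first.
    by move=> u Nu; rewrite /F indicE memNset ?mul0r ?expr0n // => /(_ Nu).
  have -> : (\int[lebesgue_measure]_(u in torus R) (G n u)%:E =
    (\int[lebesgue_measure]_(u in torus R) G n u)%:E)%E.
    by rewrite /Rintegral fineK //; apply: integrable_fin_num => //; exact: iG.
  rewrite lee_fin; set I := \int[_]_(u in _) G n u => h.
  have I0 : 0 <= I by apply: Rintegral_ge0.
  have h2 : (\int[lebesgue_measure]_(u in torus R) (F n u ^+ 2 * s u)%:E <= I%:E)%E.
    rewrite /I /Rintegral fineK; last by apply: integrable_fin_num => //; exact: iG.
    apply: ge0_le_integral => //.
    - by move=> u _; rewrite lee_fin mulr_ge0 ?sqr_ge0.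
    - apply/measurable_EFinP; apply: measurable_funTS; apply: measurable_funM => //.
      exact: measurable_funX.
    - by apply/measurable_EFinP; exact: measurable_funTS.
    - move=> u _; rewrite lee_fin /F /G indicE; case: (u \in _); last by rewrite !mul0r expr0n mul0r.
      rewrite !mul1r.
      have -> : (q u / (s u + e n)) ^+ 2 * s u =
          (q u ^+ 2 / (s u + e n)) * (s u / (s u + e n)).
        by field; rewrite gt_eqF.
      apply: ler_piMr; first by rewrite mulr_ge0 ?sqr_ge0 ?invr_ge0 ?(ltW (se _ _)).
      by rewrite ler_pdivrMr // mul1r lerDl ltW.
  have h3 : I ^+ 2 <= K * I.
    apply: (le_trans h); rewrite ler_wpM2l // -lee_fin fineK //.
    rewrite ge0_fin_numE; first exact: le_lt_trans h2 (ltry _).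
    by apply: integral_ge0 => u _; rewrite lee_fin mulr_ge0 ?sqr_ge0.
  have [->//|In] := eqVneq I 0.
  by move: h3; rewrite expr2 ler_pM2r // lt0r In.
have -> : (\int[lebesgue_measure]_(u in torus R) ((q u ^+ 2)%:E * inv_density s u) =
    \int[lebesgue_measure]_(u in torus R)
      (((\1_(~` N) u * q u ^+ 2)%R)%:E * inv_density s u))%E.
  have i0 u : (0 <= inv_density s u)%E := inv_density_ge0 s_density u.
  have mi : measurable_fun setT (inv_density s) := measurable_inv_density s_density.
  have mq2 : measurable_fun setT (fun u => ((q u ^+ 2)%:E * inv_density s u)%E).
    apply: emeasurable_funM => //; apply/measurable_EFinP; exact: measurable_funX.
  have mq3 : measurable_fun setT (fun u => (((\1_(~` N) u * q u ^+ 2)%R)%:E * inv_density s u)%E).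
    apply: emeasurable_funM => //; apply/measurable_EFinP; apply: measurable_funM.
      by apply: measurable_indic; exact: measurableC.
    exact: measurable_funX.
  rewrite [LHS](ge0_negligible_integral mN) //; last 2 first.
  - exact: measurable_funTS.
  - by move=> u _; rewrite mule_ge0 // lee_fin sqr_ge0.
  rewrite [RHS](ge0_negligible_integral mN) //; last 2 first.
  - exact: measurable_funTS.
  - by move=> u _; rewrite mule_ge0 // lee_fin mulr_ge0 ?sqr_ge0.
  apply: eq_integral => u; rewrite inE => -[_ Nu].
  by rewrite indicE mem_set // mul1r.
have mg' n : measurable_fun (torus R) (EFin \o G n).
  by apply: measurable_funTS; exact/measurable_EFinP.
have g'0 n u : torus R u -> (0 <= (EFin \o G n) u)%E by rewrite lee_fin.
have nd u : torus R u -> {homo (fun n => (EFin \o G n) u) : a b / (a <= b)%N >-> (a <= b)%E}.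
  move=> _ a b ab; rewrite lee_fin /G ler_wpM2l //.
  rewrite ler_wpM2l ?sqr_ge0 // lef_pV2 ?posrE // lerD2l.
  by rewrite lef_pV2 ?posrE // ler_nat.
have cv u : torus R u -> (EFin \o G n) u @[n --> \oo] -->
   (((\1_(~` N) u * q u ^+ 2)%R)%:E * inv_density s u)%E.
  move=> _; rewrite /G; set a := \1_(~` N) u * q u ^+ 2.
  have a0 : 0 <= a by rewrite mulr_ge0 ?sqr_ge0.
  have -> : (fun n => (\1_(~` N) u * (q u ^+ 2 / (s u + e n)))%:E) =
      fun n => (a / (s u + e n))%:E.
    by apply/funext => n; rewrite /a mulrA.
  have ce : (fun n => s u + e n) @ \oo --> s u + 0.
    by apply: cvgD; [exact: cvg_cst|exact: cvg_harmonic].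
  rewrite addr0 in ce.
  have [an|an] := eqVneq a 0.
    by rewrite an mul0e; under eq_fun do rewrite mul0r; exact: cvg_cst.
  have ap : 0 < a by rewrite lt0r an.
  rewrite /inv_density /inve; case: ifPn => [/eqP su|sn].
    rewrite su gt0_muley ?lte_fin //; apply/cvgeryP.
    under eq_fun do rewrite add0r /e invrK.
    apply/cvgryPge => A; near=> n.
    rewrite mulrC -ler_pdivrMr // (@le_trans _ _ n%:R) ?ler_nat //.
    near: n; exact: nbhs_infty_ger.
  rewrite -EFinM; apply: cvg_EFin; first by near=> n.
  by apply: cvgMl_tmp; apply: cvgV.
have cvI := cvg_monotone_convergence mT mg' g'0 nd.
suff e1 : (\int[lebesgue_measure]_(u in torus R) (limn ((fun n => EFin \o G n)^~ u)) =
   \int[lebesgue_measure]_(u in torus R)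
      (((\1_(~` N) u * q u ^+ 2)%R)%:E * inv_density s u))%E.
  by rewrite -e1; apply: (cvge_to_le (cvI lebesgue_measure)); near=> n; exact: IG.
by apply: eq_integral => u; rewrite inE => Tu; apply/cvg_lim => //; exact: cv.
Unshelve. all: by end_near.
Qed.
End WeightedUpperBound.
Section PolyOfNonrigid.
Context d (Om : measurableType d) (R : realType) (P : probability Om R).
Variable X : int -> {RV P >-> R}.
Hypotheses (X_L2 : square_integrable X) (X_centred : centred X)
  (X_stationary : wide_sense_stationary X).
Variables (S : {finite_measure set (measurableTypeR R) -> \bar R})
  (s : measurableTypeR R -> R) (m : nat).
Hypotheses (S_spectral : is_spectral_measure (autocov X) S)
  (s_density : is_ac_density S s).

Lemma weighted_trig_finite (a : int -> R) (C : R) :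
  (forall j, ~ int_window m j -> a j = 0) ->
  (forall l : seq (R[i] * int), nsq (\sum_(x <- l) x.1 * (a x.2)%:C%C) <=
        C * \int[P]_w nsq (comb X l w)) ->
  (\int[lebesgue_measure]_(u in torus R)
     ((nsq (trig (window_trig m a) u))%:E * inv_density s u) < +oo)%E.
Proof.
move=> a0 aC.
have qb := trig_pairing_bound X_L2 X_stationary S_spectral a0 aC.
set K := 2 * pi * C in qb.
have Kle F : K * \int[S]_(u in torus R) (F u) ^+ 2 <= `|K| * \int[S]_(u in torus R) (F u) ^+ 2.
  apply: ler_wpM2r; last exact: ler_norm.
  by apply: Rintegral_ge0 => u _; exact: sqr_ge0.
have [M bM] := trig_bounded (window_trig m a).
have ub1 := weighted_upper_bound s_density (measurable_trigRe (window_trig m a))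
  (fun u => (bM u).1) (fun F AF => le_trans (qb F AF).1 (Kle F)) (normr_ge0 K).
have ub2 := weighted_upper_bound s_density (measurable_trigIm (window_trig m a))
  (fun u => (bM u).2) (fun F AF => le_trans (qb F AF).2 (Kle F)) (normr_ge0 K).
have i0 u : (0 <= inv_density s u)%E := inv_density_ge0 s_density u.
have mi : measurable_fun setT (inv_density s) := measurable_inv_density s_density.
under eq_integral do rewrite /nsq EFinD ge0_muleDl ?lee_fin ?sqr_ge0 //.
rewrite ge0_integralD //=.
- by apply: (@le_lt_trans _ _ (`|K|%:E + `|K|%:E)%E); [exact: leeD|rewrite -EFinD ltry].
- exact: measurable_torus.
- by move=> u _; rewrite mule_ge0 // lee_fin sqr_ge0.
- apply: measurable_funTS; apply: emeasurable_funM => //; apply/measurable_EFinP.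
  by apply: measurable_funX; exact: measurable_trigRe.
- by move=> u _; rewrite mule_ge0 // lee_fin sqr_ge0.
- apply: measurable_funTS; apply: emeasurable_funM => //; apply/measurable_EFinP.
  by apply: measurable_funX; exact: measurable_trigIm.
Qed.

(** When [g] is 1 on the window its imaginary part is 0, so the functional comes
    from the real part, and its value on [g] is the value of [p] at 1. *)
Lemma poly_of_nonrigid (g : int -> R[i]) :
  (forall j, ~ int_window m j -> g j = 0) ->
  ~ linearly_rigid X g (int_window m) ->
  exists p : {poly R[i]}, [/\ p != 0, (size p <= (2 * m).+1)%N,
    (\int[lebesgue_measure]_(u in torus R)
     ((nsq p.[expi u])%:E * inv_density s u) < +oo)%E &
    (forall j, int_window m j -> g j = 1) -> ~~ root p 1].
Proof.
move=> g0 gn.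
have [b nb gb] : exists2 b : int -> R, real_nonrigid X m b &
    (forall j, int_window m j -> g j = 1) ->
    (forall j, int_window m j -> b j = 1) \/ (forall j, int_window m j -> b j = 0).
  have [h|h] := nonrigid_real X_L2 X_centred g0 gn.
    by eexists; [exact: h|move=> g1; left => j /g1 /= ->].
  by eexists; [exact: h|move=> g1; right => j /g1 /= ->].
have [a [C [a0 ab aC]]] := separating_coefficients X_L2 nb.
pose p : {poly R[i]} := \poly_(k < (2 * m).+1) ((a (k%:Z - m%:Z))%:C)%C.
have sp : (size p <= (2 * m).+1)%N by exact: size_poly.
have pE : window_trig m a = poly_trig m p.
  rewrite /window_trig /poly_trig /window_seq -map_comp; apply/eq_in_map => k.
  by rewrite mem_iota /= coef_poly => ->.
have sumE (f : int -> R) : \sum_(j <- window_seq m) f j =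
    \sum_(k < (2 * m).+1) f (k%:Z - m%:Z).
  by rewrite big_map -[iota _ _]/(index_iota 0 (2 * m).+1) big_mkord.
exists p; split => //.
- apply: contraTneq ab => p0; rewrite sumE big1 ?ltxx // => k _.
  have : p`_k = 0 by rewrite p0 coef0.
  by rewrite coef_poly ltn_ord => -[->]; rewrite mulr0.
- have := weighted_trig_finite a0 aC.
  by under eq_integral do rewrite pE nsq_trig_poly //.
- move=> /gb gb'.
  have {}gb' : forall j, int_window m j -> b j = 1.
    case: gb' => // b0; move: ab; rewrite big1_seq ?ltxx // => j /andP[_ /mem_window_seq jm].
    by rewrite b0 // mul0r.
  rewrite /root horner_poly; under eq_bigr do rewrite expr1n mulr1.
  apply: contraTneq ab => h.
  have : complex.Re (\sum_(k < (2 * m).+1) ((a (k%:Z - m%:Z))%:C)%C) = 0 by rewrite h.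
  rewrite Re_sum /= -(sumE a) => h2.
  rewrite (_ : \sum_(j <- window_seq m) b j * a j = 0) ?ltxx // -[RHS]h2.
  by apply: eq_big_seq => j /mem_window_seq jm; rewrite gb' // mul1r.
Qed.

End PolyOfNonrigid.

(** * Periodic functions *)
Section Translation.
Context (R : realType).
Local Open Scope ereal_scope.

Lemma lebesgue_translation (c : R) (A : set (measurableTypeR R)) : measurable A ->
  pushforward lebesgue_measure ((fun u => u + c)%R : _ -> measurableTypeR R) A =
  lebesgue_measure A.
Proof.
have mc : measurable_fun setT ((fun u => u + c)%R : measurableTypeR R -> measurableTypeR R).
  exact: measurable_funD.
move=> mA; apply/esym.
apply: (@lebesgue_measure_unique _ (pushforward lebesgue_measure _)) => //= _ [[a b]] _ <-.
rewrite /pushforward.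
have -> : (fun u => (u + c)%R) @^-1` `]a, b]%classic = `](a - c)%R, (b - c)%R]%classic.
  by apply/seteqP; split => u /=; rewrite !in_itv /= ltrBlDr lerBrDr.
rewrite !lebesgue_measure_itv /= !lte_fin ltrD2r; case: ifP => // _.
by rewrite -!EFinB; congr (_%:E); ring.
Qed.

Lemma integral_translation (c : R) (D : set (measurableTypeR R))
    (f : measurableTypeR R -> \bar R) : measurable D ->
  measurable_fun setT f -> (forall u, 0 <= f u) ->
  \int[lebesgue_measure]_(u in (fun u => u + c)%R @^-1` D) f (u + c)%R =
  \int[lebesgue_measure]_(u in D) f u.
Proof.
have mc : measurable_fun setT ((fun u => u + c)%R : measurableTypeR R -> measurableTypeR R).
  exact: measurable_funD.
move=> mD mf f0.
rewrite -(@ge0_integral_pushforward _ _ _ _ _ _ mc lebesgue_measure D f) //; last first.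
  exact: measurable_funTS.
by apply: eq_measure_integral => //= A mA AS; exact: lebesgue_translation.
Qed.

Variable f : measurableTypeR R -> \bar R.
Hypotheses (mf : measurable_fun setT f) (f0 : forall u, 0 <= f u)
  (fper : forall u, f (u + pi *+ 2)%R = f u).

Lemma integral_periodic (a b : R) (x y : bool) :
  \int[lebesgue_measure]_(u in [set` Interval (BSide x (a + pi *+ 2)%R) (BSide y (b + pi *+ 2)%R)]) f u =
  \int[lebesgue_measure]_(u in [set` Interval (BSide x a) (BSide y b)]) f u.
Proof.
rewrite -(@integral_translation (pi *+ 2)) //.
under eq_integral do rewrite fper.
congr (integral _ _ _); apply/seteqP; split => u /=;
  by rewrite !in_itv /=; case: x; case: y; rewrite /= ?lerD2r ?ltrD2r.
Qed.

Lemma finite_integral_subset (A B : set (measurableTypeR R)) : measurable A -> measurable B ->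
  A `<=` B ->
  \int[lebesgue_measure]_(u in B) f u < +oo ->
  \int[lebesgue_measure]_(u in A) f u < +oo.
Proof.
move=> mA mB AB; apply: le_lt_trans; apply: ge0_subset_integral => //.
exact: measurable_funTS.
Qed.

Lemma finite_integral_setU (A B : set (measurableTypeR R)) : measurable A -> measurable B ->
  \int[lebesgue_measure]_(u in A) f u < +oo ->
  \int[lebesgue_measure]_(u in B) f u < +oo ->
  \int[lebesgue_measure]_(u in A `|` B) f u < +oo.
Proof.
move=> mA mB Afin Bfin.
have -> : A `|` B = A `|` (B `\` A).
  apply/seteqP; split => u /=; have [Au|Au] := pselect (A u); tauto.
have mBA : measurable (B `\` A) by exact: measurableD.
rewrite ge0_integral_setU //; last 2 first.
- exact: measurable_funTS.
- by rewrite disj_set2E; apply/eqP; rewrite setDIK.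
rewrite lte_add_pinfty //; apply: finite_integral_subset Bfin => //.
Qed.

(** Intervals around points of the torus may leave the fundamental domain, but
    they stay within the two neighbouring periods. *)
Lemma finite_three_periods :
  \int[lebesgue_measure]_(u in torus R) f u < +oo ->
  \int[lebesgue_measure]_(u in [set` `[(- pi - pi *+ 2)%R, (pi + pi *+ 2)%R[]) f u < +oo.
Proof.
move=> T0; have pi0 := pi_gt0 R; have pi2 : (pi *+ 2 = pi + pi :> R)%R by rewrite mulr2n.
have T1 : \int[lebesgue_measure]_(u in [set` `[(- pi + pi *+ 2)%R, (pi + pi *+ 2)%R[]) f u < +oo.
  by rewrite integral_periodic.
have T2 : \int[lebesgue_measure]_(u in [set` `[(- pi - pi *+ 2)%R, (pi - pi *+ 2)%R[]) f u < +oo.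
  by rewrite -integral_periodic !subrK.
have mi (a b : R) : measurable ([set` `[a, b[] : set (measurableTypeR R)) by exact: measurable_itv.
have h := finite_integral_setU (measurableU _ _ (mi _ _) (mi _ _)) (mi _ _)
   (finite_integral_setU (mi _ _) (mi _ _) T2 T0) T1.
apply: finite_integral_subset h => //.
  by apply: measurableU => //; exact: measurableU.
clear T0 T1 T2; move=> u; rewrite /= !in_itv /= pi2 => /andP[u1 u2].
have [u3|u3] := ltP u (- pi)%R; first by left; left; apply/andP; split; lra.
have [u4|u4] := ltP u pi%R; first by left; right; apply/andP; split; lra.
by right; apply/andP; split; lra.
Qed.

End Translation.

(** * From a polynomial to the poles *)
Section PolesOfPoly.
Context (R : realType).
Variables (S : {finite_measure set (measurableTypeR R) -> \bar R})
  (s : measurableTypeR R -> R).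
Hypothesis s_density : is_ac_density S s.

Let w0 u : (0 <= inv_density s u)%E := inv_density_ge0 s_density u.
Let mw : measurable_fun setT (inv_density s) := measurable_inv_density s_density.

Lemma continuous_nsq_horner (p : {poly R[i]}) :
  continuous (fun u : R => nsq p.[expi u]).
Proof.
have sp : (size p <= (2 * size p).+1)%N by lia.
have -> : (fun u : R => nsq p.[expi u]) = fun u => nsq (trig (poly_trig (size p) p) u).
  by apply/funext => u; rewrite nsq_trig_poly.
have [cr ci] := continuous_trig (poly_trig (size p) p).
move=> u; rewrite /nsq; apply: cvgD; rewrite !expr2.
  under eq_fun do rewrite expr2; apply: cvgM; exact: cr.
under eq_fun do rewrite expr2; apply: cvgM; exact: ci.
Qed.

Definition weight (p : {poly R[i]}) (u : measurableTypeR R) : \bar R :=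
  ((nsq p.[expi u])%:E * inv_density s u)%E.

Lemma measurable_weight p : measurable_fun setT (weight p).
Proof.
apply: emeasurable_funM => //; apply/measurable_EFinP.
by apply: continuous_measurable_fun; exact: continuous_nsq_horner.
Qed.

Lemma weight_ge0 p u : (0 <= weight p u)%E.
Proof. by rewrite mule_ge0 // lee_fin nsq_ge0. Qed.

Lemma weight_periodic p u : weight p (u + pi *+ 2) = weight p u.
Proof.
by have [_ _ sper _] := s_density; rewrite /weight expiD2pi /inv_density sper.
Qed.

Let XsubC (u0 : R) : {poly R[i]} := 'X - (expi u0)%:P.

Lemma cancelsP u0 k : cancels_pole s u0 k <-> exists2 e : R, 0 < e &
  (\int[lebesgue_measure]_(u in [set` `[u0 - e, u0 + e]%R])
    weight (XsubC u0 ^+ k) u < +oo)%E.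
Proof.
have E (D : set (measurableTypeR R)) :
    (\int[lebesgue_measure]_(u in D)
       ((Normc.normc (expi u - expi u0) ^+ (2 * k))%:E * inv_density s u) =
     \int[lebesgue_measure]_(u in D) weight (XsubC u0 ^+ k) u)%E.
  apply: eq_integral => u _.
  by rewrite /weight horner_exp hornerXsubC nsqX exprM sqr_normcE.
by split=> -[e e0]; [rewrite E|rewrite -E] => h; exists e.
Qed.

Lemma cancels0_not_pole u0 : cancels_pole s u0 0 -> ~ is_pole s u0.
Proof.
move=> [e e0]; under eq_integral do rewrite muln0 expr0 mul1e.
move=> fin /(_ (ball u0 e)); apply; first by split; [exact: ball_open|exact: ballxx].
apply/integrableP; split; first exact: measurable_funTS.
under eq_integral do rewrite gee0_abs //.
apply: le_lt_trans fin; apply: ge0_subset_integral => //.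
- exact: measurable_ball.
- exact: measurable_funTS.
- by move=> u; rewrite ball_itv /= !in_itv /= => /andP[? ?]; rewrite !ltW.
Qed.

Lemma not_pole_cancels0 u0 : ~ is_pole s u0 -> cancels_pole s u0 0.
Proof.
move=> /existsNP[U /not_implyP[oU /contrapT/integrableP[mU fin]]].
have [oo Uu] := oU.
have /nbhs_ballP[e /= e0 eU] : nbhs u0 U by apply: open_nbhs_nbhs.
exists (e / 2); first by rewrite divr_gt0.
under eq_integral do rewrite muln0 expr0 mul1e.
apply: le_lt_trans fin; under [leRHS]eq_integral do rewrite gee0_abs //.
apply: ge0_subset_integral => //.
- exact: open_measurable.
- move=> u ue; apply: eU; rewrite ball_itv /=; move: ue; rewrite /= !in_itv /=; lra.
Qed.

Lemma weight_dominated (p q : {poly R[i]}) (M : R) (D : set (measurableTypeR R)) :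
  measurable D -> 0 <= M ->
  (forall u, D u -> nsq p.[expi u] <= M * nsq q.[expi u]) ->
  (\int[lebesgue_measure]_(u in D) weight q u < +oo)%E ->
  (\int[lebesgue_measure]_(u in D) weight p u < +oo)%E.
Proof.
move=> mD M0 pq fin.
apply: (@le_lt_trans _ _ (\int[lebesgue_measure]_(u in D) (M%:E * weight q u))%E).
  apply: ge0_le_integral => //.
  - by move=> u _; exact: weight_ge0.
  - by apply: measurable_funTS; exact: measurable_weight.
  - by apply: measurable_funTS; apply: measurable_funeM; exact: measurable_weight.
  - move=> u Du; rewrite /weight muleA -EFinM lee_wpmul2r //.
    by rewrite lee_fin pq.
rewrite ge0_integralZl_EFin //.
- by rewrite lte_mul_pinfty // ?lee_fin.
- by move=> u _; exact: weight_ge0.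
- by apply: measurable_funTS; exact: measurable_weight.
Qed.

(** Near the zero the remaining factor [q] is bounded below, so that [p] controls
    the power of the linear factor. *)
Lemma multiplicity_cancels (p q : {poly R[i]}) k u0 :
  - pi <= u0 < pi -> p = q * XsubC u0 ^+ k -> ~~ root q (expi u0) ->
  (\int[lebesgue_measure]_(u in torus R) weight p u < +oo)%E ->
  cancels_pole s u0 k.
Proof.
move=> /andP[u1 u2] pE qn0 fin; apply/cancelsP; have pi0 := pi_gt0 R.
set d := nsq q.[expi u0].
have d0 : 0 < d by rewrite nsq_gt0.
have d2 : d / 2 < d by lra.
have near_d : \forall u \near u0, d / 2 < nsq q.[expi u].
  exact: (cvgr_gt _ (@continuous_nsq_horner q u0) _ d2).
move: near_d => /nbhs_ballP[e /= e0 he].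
pose e' := Num.min (e / 2) pi.
have e'0 : 0 < e' by rewrite lt_min divr_gt0.
have e'e : e' <= e / 2 by rewrite ge_min lexx.
have e'pi : e' <= pi by rewrite ge_min lexx orbT.
exists e' => //.
have pi2 : pi *+ 2 = pi + pi :> R by rewrite mulr2n.
have mi (a b : R) : measurable ([set` `[a, b]] : set (measurableTypeR R)) by exact: measurable_itv.
have mi' (a b : R) : measurable ([set` `[a, b[] : set (measurableTypeR R)) by exact: measurable_itv.
apply: (@weight_dominated _ p (2 / d)) => //.
- by rewrite divr_ge0 // ltW.
- move=> u; rewrite /= in_itv /= => /andP[v1 v2].
  have /he /= dq : ball u0 e u by rewrite ball_itv /= in_itv /=; apply/andP; split; lra.
  rewrite pE hornerM nsqM mulrA ler_peMl ?nsq_ge0 //.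
  by rewrite mulrC mulrA ler_pdivlMr // mul1r mulrC -ler_pdivrMl //; rewrite mulrC ltW.
- have h3 := finite_three_periods (measurable_weight p) (weight_ge0 p)
    (weight_periodic p) fin.
  apply: (finite_integral_subset (measurable_weight p) (weight_ge0 p) (mi _ _) (mi' _ _) _ h3).
  clear h3; move=> u; rewrite /= !in_itv /= pi2 => /andP[v1 v2].
  by apply/andP; split; lra.
Qed.

(** Powers of distinct linear factors are coprime, so their product divides
    [p]. *)
Lemma sum_multiplicities (p : {poly R[i]}) (r : seq R[i]) (k : R[i] -> nat) :
  p != 0 -> uniq r -> (forall z, z \in r -> ('X - z%:P) ^+ k z %| p) ->
  (\sum_(z <- r) k z < size p)%N.
Proof.
move=> p0 ur hd.
have : \prod_(z <- r) ('X - z%:P) ^+ k z %| p.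
  elim: r ur hd => [|z r IH] /=; first by rewrite big_nil dvd1p.
  move=> /andP[zr ur] hd; rewrite big_cons Gauss_dvdp; last first.
    rewrite big_seq; elim/big_ind: _ => [|x y cx cy|x xr]; first by rewrite coprimep1.
      by rewrite coprimepMr cx cy.
    apply/coprimep_expl/coprimep_expr/coprimep_XsubC2.
    by rewrite subr_eq0; apply: contraNneq zr => <-.
  rewrite hd ?mem_head // IH // => x xr; apply: hd; by rewrite inE xr orbT.
move=> /(dvdp_leq p0); apply: leq_trans.
suff -> : size (\prod_(z <- r) ('X - z%:P) ^+ k z) = (\sum_(z <- r) k z).+1 by [].
elim: r {ur hd} => [|z r IH]; first by rewrite !big_nil size_poly1.
rewrite !big_cons size_monicM ?monic_exp ?monicXsubC //; last first.
  by apply: monic_neq0; apply: monic_prod => x _; rewrite monic_exp ?monicXsubC.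
by rewrite IH size_exp_XsubC addSn addnS.
Qed.

(** The order of a pole is at most the multiplicity of the corresponding zero of
    [p], and distinct poles give distinct zeros. *)
Lemma nb_poles_le (p : {poly R[i]}) (n : nat) : p != 0 -> (size p <= n.+1)%N ->
  (\int[lebesgue_measure]_(u in torus R) weight p u < +oo)%E ->
  (nb_poles s <= (n%:R)%:E)%E.
Proof.
move=> p0 sp fin.
have mult z : {k : nat | exists2 q, ~~ root q z & p = q * ('X - z%:P) ^+ k}.
  have [k hk] := multiplicity_XsubC p z; exists k.
  by case: hk => q; rewrite p0 /= => qz pE; exists q.
pose k z := sval (mult z).
have kc u : - pi <= u < pi -> cancels_pole s u (k (expi u)).
  move=> u12; have [q qz pE] := svalP (mult (expi u)).
  exact: multiplicity_cancels qz fin.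
apply: ge_ereal_sup => _ [A [fA sA] <-].
rewrite fsbig_finite //=.
set r := finmap.enum_fset (fset_set A).
have rA u : u \in r -> A u by rewrite in_fset_set // inE.
have ur : uniq r by exact: finmap.fset_uniq.
apply: (@le_trans _ _ (\sum_(u <- r) ((k (expi u))%:R)%:E)%E).
  rewrite big_seq [leRHS]big_seq; apply: lee_sum => u /rA /sA [u12 _].
  by apply: ereal_inf_lbound; exists (k (expi u)) => //; exact: kc.
rewrite sumEFin lee_fin -natr_sum ler_nat -ltnS.
apply: leq_trans sp; rewrite -(big_map (@expi R) predT).
apply: sum_multiplicities => //.
  rewrite map_inj_in_uniq // => u v /rA /sA [u12 _] /rA /sA [v12 _]; exact: expi_inj.
move=> z _; have [q _ {1}->] := svalP (mult z); exact: dvdp_mull.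
Qed.

Lemma not_pole_of_root (p : {poly R[i]}) u0 : - pi <= u0 < pi ->
  ~~ root p (expi u0) ->
  (\int[lebesgue_measure]_(u in torus R) weight p u < +oo)%E -> ~ is_pole s u0.
Proof.
move=> u12 pn fin; apply: cancels0_not_pole.
by apply: (multiplicity_cancels u12 _ pn fin); rewrite expr0 mulr1.
Qed.

End PolesOfPoly.

(** * From the poles to a polynomial *)
Section PolyOfPoles.
Context (R : realType).
Variables (S : {finite_measure set (measurableTypeR R) -> \bar R})
  (s : measurableTypeR R -> R).
Hypothesis s_density : is_ac_density S s.

Let poles := [set u : R | - pi <= u < pi /\ is_pole s u].

Let w0 p u : (0 <= weight s p u)%E := weight_ge0 s_density p u.
Let mw p : measurable_fun setT (weight s p) := measurable_weight s_density p.

Lemma pole_order_ge1 u : is_pole s u -> (1%:E <= pole_order s u)%E.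
Proof.
move=> up; apply: le_ereal_inf_tmp => _ [k ck <-].
rewrite lee_fin ler1n lt0n; apply/eqP => k0; rewrite k0 in ck.
by have := cancels0_not_pole s_density ck.
Qed.

Lemma pole_order_attained u : (pole_order s u < +oo)%E ->
  exists2 k, cancels_pole s u k & pole_order s u = (k%:R)%:E.
Proof.
move=> /ereal_inf_lt[_ [k0 ck0 <-] _].
have ex : exists k, `[< cancels_pole s u k >] by exists k0; apply/asboolP.
exists (ex_minn ex); case: ex_minnP => k /asboolP ck kmin //.
apply/eqP; rewrite eq_le; apply/andP; split.
  by apply: ereal_inf_lbound; exists k.
apply: le_ereal_inf_tmp => _ [j cj <-].
by rewrite lee_fin ler_nat; apply: kmin; apply/asboolP.
Qed.

Lemma nsq_horner_bounded (p : {poly R[i]}) :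
  exists2 M : R, 0 <= M & forall u, nsq p.[expi u] <= M.
Proof.
have sp : (size p <= (2 * size p).+1)%N by lia.
have [M hM] := trig_bounded (poly_trig (size p) p).
exists (M ^+ 2 + M ^+ 2); first by rewrite addr_ge0 ?sqr_ge0.
move=> u; rewrite -(nsq_trig_poly u sp) /nsq; have [h1 h2] := hM u.
by apply: lerD; rewrite -real_normK ?num_real // lerXn2r ?nnegrE //; apply: le_trans h1.
Qed.

(** Compactness of the closed period; the end point [pi] is represented by
    [- pi], through periodicity. *)
Lemma weight_finite_of_local (p : {poly R[i]}) :
  (forall u0, - pi <= u0 < pi -> exists2 e : R, 0 < e &
     (\int[lebesgue_measure]_(u in [set` `[u0 - e, u0 + e]%R]) weight s p u < +oo)%E) ->
  (\int[lebesgue_measure]_(u in torus R) weight s p u < +oo)%E.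
Proof.
move=> loc; have pi0 := pi_gt0 R.
have {}loc u0 : exists e : R, - pi <= u0 <= pi -> 0 < e /\
     (\int[lebesgue_measure]_(u in [set` `[u0 - e, u0 + e]%R]) weight s p u < +oo)%E.
  have [/andP[u1]|u12] := boolP (- pi <= u0 <= pi); last by exists 0.
  rewrite le_eqVlt => /predU1P[->|u2]; last first.
    by have [|e e0 he] := loc u0; [rewrite u1|exists e].
  have [|e e0 he] := loc (- pi); first by rewrite lexx /=; lra.
  have e1 : pi - e = - pi - e + pi *+ 2 by rewrite mulr2n; ring.
  have e2 : pi + e = - pi + e + pi *+ 2 by rewrite mulr2n; ring.
  exists e => _; split => //.
  by rewrite e1 e2 (integral_periodic (mw p) (w0 p) (weight_periodic s_density p)).
have [e he] := choice loc.
have cK : compact [set` `[- pi, pi]%R : interval R] by exact: segment_compact.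
rewrite compact_cover in cK.
have [||D' sD cov] := cK R [set` `[- pi, pi]%R] (fun u => ball u (e u)).
- by move=> u _; exact: ball_open.
- move=> u uK; exists u => //=; apply: ballxx.
  by have [] := he u; first by move: uK; rewrite /= in_itv.
have mi (a b : R) : measurable ([set` `[a, b]] : set (measurableTypeR R)) by exact: measurable_itv.
pose U := \big[setU/set0]_(v <- finmap.enum_fset D') [set` `[v - e v, v + e v]%R].
have [mU Ufin] : measurable (U : set (measurableTypeR R)) /\
    (\int[lebesgue_measure]_(u in U) weight s p u < +oo)%E.
  rewrite /U big_seq; elim/big_ind: _ => [|A B [mA fA] [mB fB]|v vD].
  - by rewrite integral_set0.
  - by split; [exact: measurableU|exact: (finite_integral_setU (mw p) (w0 p))].
  - split; first exact: mi.
    have vK : [set` `[- pi, pi]%R] v by have := sD v vD; rewrite inE.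
    by have [] := he v; first by move: vK; rewrite /= in_itv.
apply: (finite_integral_subset (mw p) (w0 p) (@measurable_torus R) mU _ Ufin) => u uT.
have uK : [set` `[- pi, pi]%R] u.
  by move: uT; rewrite /torus /= !in_itv /= => /andP[-> /ltW].
have [v vD vu] := cov u uK.
rewrite /U -bigcup_seq; exists v => //=.
by move: vu; rewrite ball_itv /= !in_itv /= => /andP[? ?]; rewrite !ltW.
Qed.

(** As every pole has order at least 1, there are finitely many of them, each of
    finite order; the product of the linear factors with these exponents cancels
    all of them. *)
Lemma poly_of_nb_poles (n : nat) : (nb_poles s <= (n%:R)%:E)%E ->
  exists p : {poly R[i]}, [/\ p != 0, (size p <= n.+1)%N,
    (\int[lebesgue_measure]_(u in torus R) weight s p u < +oo)%E &
    ~ is_pole s 0 -> ~~ root p 1].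
Proof.
move=> hn.
have sub (A : set R) : finite_set A -> A `<=` poles ->
    (\sum_(u <- finmap.enum_fset (fset_set A)) pole_order s u <= (n%:R)%:E)%E.
  move=> fA sA; rewrite -fsbig_finite //; apply: le_trans hn.
  by apply: esum_ge; exists A.
have o0 u : poles u -> (1%:E <= pole_order s u)%E by move=> [_]; exact: pole_order_ge1.
have fin : finite_set poles.
  apply: contrapT => /(infinite_set_fset n.+1)[B sB cB].
  have := sub _ (finite_fset B) sB; rewrite set_fsetK; apply/negP; rewrite -ltNge.
  apply: (@lt_le_trans _ _ (\sum_(u <- finmap.enum_fset B) 1%:E)%E).
    rewrite sumEFin lte_fin big_const_seq count_predT iter_addr addr0.
    by rewrite ltr_nat.
  by rewrite big_seq [leRHS]big_seq; apply: lee_sum => u uB; apply/o0/sB.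
have kex u : exists k : nat, (poles u -> cancels_pole s u k /\ pole_order s u = (k%:R)%:E)
    /\ (~ poles u -> k = 0%N).
  have [pu|npu] := pselect (poles u); last by exists 0%N.
  have [|k ck ek] := @pole_order_attained u; last by exists k.
  apply: le_lt_trans (ltry n%:R); have := sub [set u] (finite_set1 u).
  rewrite -fsbig_finite // fsbig_set1; apply; by move=> _ ->.
have [k hk] := choice kex.
set r := finmap.enum_fset (fset_set poles).
have rP u : (u \in r) <-> poles u by rewrite in_fset_set //; split => [|?]; rewrite inE.
have ur : uniq r by exact: finmap.fset_uniq.
have sumk : (\sum_(u <- r) k u <= n)%N.
  rewrite -(ler_nat R) natr_sum -lee_fin -sumEFin; apply: le_trans (sub _ fin _) => //.
  by rewrite big_seq [leRHS]big_seq; apply: lee_sum => u /rP /(hk u).1[_ ->].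
pose p : {poly R[i]} := \prod_(u <- r) ('X - (expi u)%:P) ^+ k u.
have mon q : (\prod_(u <- q) ('X - (expi u)%:P) ^+ k u : {poly R[i]}) \is monic.
  by apply: monic_prod => u _; rewrite monic_exp ?monicXsubC.
have size_p : size p = (\sum_(u <- r) k u).+1.
  rewrite /p; elim: (r) => [|u q IH]; first by rewrite !big_nil size_poly1.
  rewrite !big_cons size_monicM ?monic_exp ?monicXsubC ?monic_neq0 //.
  by rewrite IH size_exp_XsubC addSn addnS.
exists p; split.
- exact/monic_neq0/mon.
- by rewrite size_p ltnS.
- apply: weight_finite_of_local => u0 u12.
  have [q pE] : exists q, p = q * ('X - (expi u0)%:P) ^+ k u0.
    have [pu|npu] := pselect (poles u0); last first.
      by exists p; rewrite (hk u0).2 // expr0 mulr1.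
    have ru : u0 \in r by apply/rP.
    eexists; rewrite /p (bigD1_seq u0) //= mulrC; reflexivity.
  have : cancels_pole s u0 (k u0).
    have [pu|npu] := pselect (poles u0); first exact: ((hk u0).1 pu).1.
    rewrite (hk u0).2 //; apply: (not_pole_cancels0 s_density) => up.
    by apply: npu.
  move=> /cancelsP[e e0 he]; exists e => //.
  have [M M0 hM] := nsq_horner_bounded q.
  apply: (weight_dominated s_density _ M0 _ he); first exact: measurable_itv.
  by move=> u _; rewrite pE hornerM nsqM ler_wpM2r ?nsq_ge0.
- move=> np0; rewrite /root horner_prod prodf_seq_neq0; apply/allP => u /rP [u12 up].
  rewrite /= horner_exp hornerXsubC expf_neq0 // subr_eq0 eq_sym.
  apply: contra_notN np0 => /eqP; rewrite -(expi0 R) => /expi_inj u0.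
  by rewrite -u0 // oppr_le0 pi_ge0 pi_gt0.
Qed.

End PolyOfPoles.

(** * The characterization *)
Theorem proposition6 (R : realType) (d : measure_display)
    (Om : measurableType d) (P : probability Om R)
    (X : int -> {RV P >-> R})
    (S : {finite_measure set (measurableTypeR R) -> \bar R})
    (s : measurableTypeR R -> R) (m : nat)
    (X_L2 : square_integrable X)
    (X_centred : centred X)
    (X_stationary : wide_sense_stationary X)
    (X_var : ('V_P[X 0%R] = 1)%E)
    (S_spectral : is_spectral_measure (autocov X) S)
    (s_density : is_ac_density S s) :
  (~ linearly_maximally_rigid X (int_window m) <->
     (nb_poles s <= ((2 * m)%:R)%:E)%E) /\
  (~ linearly_0_rigid X (int_window m) <->
     (nb_poles s <= ((2 * m)%:R)%:E)%E /\ ~ is_pole s 0).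
Proof.
have pi0 := pi_gt0 R.
have window k : (k < (2 * m).+1)%N -> int_window m (k%:Z - m%:Z).
  by rewrite /int_window /= => km; lia.
split; split.
- move=> /existsNP[g /not_implyP[g0 gn]].
  have [p [p0 sp fin _]] :=
    poly_of_nonrigid X_L2 X_centred X_stationary S_spectral s_density g0 gn.
  exact: (nb_poles_le s_density p0 sp fin).
- move=> /(poly_of_nb_poles s_density)[p [p0 sp fin _]] rigid.
  have := rigid (coef (poly_trig m p)) (@coef_poly_trig_off _ m p).
  apply: (nonrigid_of_poly X_L2 X_centred X_stationary S_spectral s_density
    (@coef_poly_trig_off _ m p) sp fin).
  rewrite Re_sum; under eq_bigr => k _.
    rewrite coef_poly_trig -?nsqE; last by rewrite -ltnS.
    over.
  have sp0 : (0 < size p)%N by rewrite size_poly_gt0.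
  have lc : ((size p).-1 < (2 * m).+1)%N by rewrite prednK.
  rewrite (bigD1 (Ordinal lc)) //= ltr_wpDr //.
    by apply: sumr_ge0 => k _; exact: nsq_ge0.
  by rewrite nsq_gt0 -lead_coefE lead_coef_eq0.
- have g0 j : ~ int_window m j -> (\1_(int_window m) j : R[i]) = 0.
    by move=> jm; rewrite indicE memNset.
  move=> gn; have [p [p0 sp fin p1]] :=
    poly_of_nonrigid X_L2 X_centred X_stationary S_spectral s_density g0 gn.
  split; first exact: (nb_poles_le s_density p0 sp fin).
  apply: (not_pole_of_root s_density _ _ fin).
    by rewrite oppr_le0 pi_ge0 pi_gt0.
  by rewrite expi0; apply: p1 => j jm; rewrite indicE mem_set.
- move=> [/(poly_of_nb_poles s_density)[p [p0 sp fin p1]] np].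
  have {}p1 := p1 np.
  have g0 j : ~ int_window m j -> (\1_(int_window m) j : R[i]) = 0.
    by move=> jm; rewrite indicE memNset.
  (* Dividing by the value at 1 makes the pairing with the indicator equal 1. *)
  pose q := p.[1]^-1 *: p.
  have pn : p.[1] != 0 by [].
  have sq : (size q <= (2 * m).+1)%N by rewrite size_scale ?invr_eq0.
  have qfin : (\int[lebesgue_measure]_(u in torus R)
     ((nsq q.[expi u])%:E * inv_density s u) < +oo)%E.
    apply: (weight_dominated s_density (@measurable_torus R) (nsq_ge0 p.[1]^-1) _ fin).
    by move=> u _; rewrite hornerZ nsqM.
  apply: (nonrigid_of_poly X_L2 X_centred X_stationary S_spectral s_density g0 sq qfin).
  have -> : \sum_(k < (2 * m).+1) \1_(int_window m) (k%:Z - m%:Z) * ((q`_k)^*)%C = 1.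
    have one (k : 'I_(2 * m).+1) : (\1_(int_window m) (k%:Z - m%:Z) : R[i]) = 1.
      by rewrite indicE mem_set //; exact: window.
    under eq_bigr => k _ do rewrite one mul1r.
    rewrite -conj_sum (_ : \sum_(k < _) _ = q.[1]).
      by rewrite hornerZ mulVf // /= oppr0.
    rewrite (horner_coef_wide _ sq); by apply: eq_bigr => k _; rewrite expr1n mulr1.
  by [].
Qed.
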